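(* Let $\mathbb{F}$ be any field and let $\mathcal{A}$ be an $r$-dimensional (associative, not necessarily commutative) algebra over $\mathbb{F}$ with basis $e_1,\dots,e_r$. Let $A=(A_{i,j})_{1\le i\le k,1\le j\le n}$ be a $k\times n$ matrix with entries $A_{i,j}\in\mathcal{A}$. Then $\mathrm{rper}(A)=\sum_{f\in I_{k,n}}A_{1,f(1)}A_{2,f(2)}\cdots A_{k,f(k)}$ and $\mathrm{rdet}(A)=\sum_{S\subseteq[n],|S|=k}\sum_{\sigma\in S_k}\mathrm{sgn}(\sigma)A_{1,s_{\sigma(1)}}\cdots A_{k,s_{\sigma(k)}}$ (where $S=\{s_1<\dots<s_k\}$) can be computed in deterministic $O^*(2^k r^{2k})$ time.
   Context: $I_{k,n}$ is the set of injections $[k]\to[n]$. Products in $\mathcal{A}$ are taken in the written order. $O^*(\cdot)$ suppresses factors polynomial in the input size ($n$, $k$, $r$). *)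

(* Defs.v *)
From HB Require Import structures.
From mathcomp Require Import all_boot all_order all_algebra all_fingroup.

Set Implicit Arguments.
Unset Strict Implicit.
Unset Printing Implicit Defensive.

Import GRing.Theory.

Local Open Scope ring_scope.

(** * Algebras, rectangular permanents and determinants *)

(* Possibly non-commutative and possibly non-unital, hence not falgType. *)
Record is_algebra (F : fieldType) (V : vectType F) (mul : V -> V -> V) : Prop :=
  IsAlgebra {
    algebra_assoc : associative mul;
    algebra_linearr : forall x, linear (mul x);
    algebra_linearl : forall y, linear (mul^~ y)
  }.

(* The product x_1 x_2 ... x_m in this order; [u] is the empty product. *)
Definition oprod (V : Type) (mul : V -> V -> V) (u : V) (s : seq V) : V :=
  if s is x :: s' then foldl mul x s' else u.

Definition rper (F : fieldType) (V : vectType F) (mul : V -> V -> V) (u : V)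
    (k n : nat) (A : 'M[V]_(k, n)) : V :=
  \sum_(f : {ffun 'I_k -> 'I_n} | injectiveb f)
    oprod mul u [seq A i (f i) | i <- enum 'I_k].

(* [enum S] lists S in increasing order, so that, as #|S| = k, the entry
   A i s_(sigma i) is the one of rank (sigma i) in row i restricted to S; the
   default value of [nth] is never used. *)
Definition rdet (F : fieldType) (V : vectType F) (mul : V -> V -> V) (u : V)
    (k n : nat) (A : 'M[V]_(k, n)) : V :=
  \sum_(S : {set 'I_n} | #|S| == k) \sum_(sigma : 'S_k)
    (-1) ^+ sigma *:
      oprod mul u
        [seq nth 0 [seq A i j | j <- enum S] (sigma i) | i <- enum 'I_k].

(** * A deterministic random access machine over a field

  The machine has a memory of natural numbers and a memory of field elements,
  both indexed by nat.  Field operations and zero tests have unit cost.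
  Integers are charged by the logarithmic cost criterion: every integer
  (operand, result or address) occurring in an evaluation costs its bit length.
  Programs do not mention the field, so one program runs over all fields. *)

Inductive iexp : Type :=
| IConst of nat
| ILoad of iexp
| IAdd of iexp & iexp
| ISub of iexp & iexp
| IMul of iexp & iexp
| IDiv of iexp & iexp.

Inductive fexp : Type :=
| FZero
| FOne
| FLoad of iexp
| FOpp of fexp
| FAdd of fexp & fexp
| FMul of fexp & fexp
| FInv of fexp.

Inductive test : Type :=
| TLe of iexp & iexp
| TFZero of fexp.

Inductive cmd : Type :=
| Skip
| IStore of iexp & iexp
| FStore of iexp & fexp
| Seq of cmd & cmd
| If of test & cmd & cmd
| While of test & cmd.

Record ram (F : Type) : Type := Ram { imem : nat -> nat; fmem : nat -> F }.

(* trunc_log 2 0 = 0, so that 0 has bit length 1 *)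
Definition bitlen (m : nat) : nat := (trunc_log 2 m).+1.

Section Semantics.
Variable F : fieldType.
Implicit Type s : ram F.

Fixpoint ieval s (e : iexp) : nat :=
  match e with
  | IConst m => m
  | ILoad a => imem s (ieval s a)
  | IAdd a b => (ieval s a + ieval s b)%N
  | ISub a b => (ieval s a - ieval s b)%N
  | IMul a b => (ieval s a * ieval s b)%N
  | IDiv a b => (ieval s a %/ ieval s b)%N
  end.

Fixpoint icost s (e : iexp) : nat :=
  (bitlen (ieval s e) +
   match e with
   | IConst _ => 0
   | ILoad a => icost s a
   | IAdd a b | ISub a b | IMul a b | IDiv a b => icost s a + icost s b
   end)%N.

Fixpoint feval s (e : fexp) : F :=
  match e with
  | FZero => 0
  | FOne => 1
  | FLoad a => fmem s (ieval s a)
  | FOpp x => - feval s x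
  | FAdd x y => feval s x + feval s y
  | FMul x y => feval s x * feval s y
  | FInv x => (feval s x)^-1
  end.

Fixpoint fcost s (e : fexp) : nat :=
  match e with
  | FZero | FOne => 1
  | FLoad a => (icost s a).+1
  | FOpp x | FInv x => (fcost s x).+1
  | FAdd x y | FMul x y => (fcost s x + fcost s y).+1
  end.

Definition teval s (b : test) : bool :=
  match b with
  | TLe x y => (ieval s x <= ieval s y)%N
  | TFZero x => feval s x == 0
  end.

Definition tcost s (b : test) : nat :=
  match b with
  | TLe x y => (icost s x + icost s y).+1
  | TFZero x => (fcost s x).+1
  end.

(* [exec c s t s']: started in s, the program c halts in s' after time t. *)
Inductive exec : cmd -> ram F -> nat -> ram F -> Prop :=
| exec_skip s : exec Skip s 1 s
| exec_istore a x s :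
    exec (IStore a x) s (icost s a + icost s x).+1
      (Ram [eta imem s with ieval s a |-> ieval s x] (fmem s))
| exec_fstore a x s :
    exec (FStore a x) s (icost s a + fcost s x).+1
      (Ram (imem s) [eta fmem s with ieval s a |-> feval s x])
| exec_seq c1 c2 s t1 s1 t2 s2 :
    exec c1 s t1 s1 -> exec c2 s1 t2 s2 -> exec (Seq c1 c2) s (t1 + t2) s2
| exec_if b c1 c2 s t s' :
    exec (if teval s b then c1 else c2) s t s' ->
    exec (If b c1 c2) s (tcost s b + t) s'
| exec_while_false b c s :
    ~~ teval s b -> exec (While b c) s (tcost s b) s
| exec_while_true b c s t1 s1 t2 s2 :
    teval s b -> exec c s t1 s1 -> exec (While b c) s1 t2 s2 ->
    exec (While b c) s (tcost s b + t1 + t2) s2.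

Lemma exec_det c s t1 s1 t2 s2 :
  exec c s t1 s1 -> exec c s t2 s2 -> t1 = t2 /\ s1 = s2.
Proof.
move=> h; elim: h t2 s2 => {c s t1 s1}.
- by move=> s t2 s2; inversion 1.
- by move=> a x s t2 s2; inversion 1.
- by move=> a x s t2 s2; inversion 1.
- move=> c1 c2 s t1 s1 t2 s2 _ IH1 _ IH2 t s'.
  inversion 1 as [| | |? ? ? ? ? ? ? h1 h2| | |]; subst.
  by case: (IH1 _ _ h1) => ? ?; subst; case: (IH2 _ _ h2) => -> ->.
- move=> b c1 c2 s t s' _ IH t2 s2.
  by inversion 1 as [| | | |? ? ? ? ? ? h1| |]; subst; case: (IH _ _ h1) => -> ->.
- move=> b c s nb t2 s2.
  inversion 1 as [| | | | | |? ? ? ? ? ? ? hb]; subst => //.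
  by rewrite hb in nb.
- move=> b c s t1 s1 t2 s2 hb _ IH1 _ IH2 t s'.
  inversion 1 as [| | | | |? ? ? nb|? ? ? ? ? ? ? _ h1 h2]; subst.
    by rewrite hb in nb.
  by case: (IH1 _ _ h1) => ? ?; subst; case: (IH2 _ _ h2) => -> ->.
Qed.

End Semantics.

(** * Encoding of the input, and running time *)

Definition coords (F : fieldType) (V : vectType F) (r : nat) (e : r.-tuple V)
    (v : V) : seq F :=
  [seq coord e l v | l <- enum 'I_r].

(* Structure constants of the algebra, then the coordinates of the empty
   product, then those of the entries of A in row-major order. *)
Definition field_input (F : fieldType) (V : vectType F) (mul : V -> V -> V)
    (u : V) (r : nat) (e : r.-tuple V) (k n : nat) (A : 'M[V]_(k, n)) : seq F :=
  flatten [seq coords e (mul (tnth e a) (tnth e b)) | a <- enum 'I_r,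
                                                      b <- enum 'I_r]
  ++ coords e u
  ++ flatten [seq coords e (A i j) | i <- enum 'I_k, j <- enum 'I_n].

Definition init_ram (F : fieldType) (V : vectType F) (mul : V -> V -> V)
    (u : V) (r : nat) (e : r.-tuple V) (k n : nat) (A : 'M[V]_(k, n)) : ram F :=
  Ram (nth 0%N [:: n; k; r]) (nth 0 (field_input mul u e A)).

(* T = O^*(f): factors polynomial in n, k and r are suppressed.  As usual f is
   read as max(1, f); this only matters for r = 0, where r^(2k) may vanish. *)
Definition Ostar (T f : nat -> nat -> nat -> nat) : Prop :=
  exists c : nat, forall n k r : nat,
    (T n k r <= c * (n + k + r).+1 ^ c * maxn 1 (f n k r))%N.

(* On halting, field cells 0, ..., r-1 hold the coordinates of the result.  The
   empty product u is only relevant for k = 0, and is then the identity of the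
   algebra; for k > 0 no identity is assumed to exist. *)
Definition computable_in_Ostar
    (g : forall (F : fieldType) (V : vectType F) (mul : V -> V -> V) (u : V)
           (k n : nat), 'M[V]_(k, n) -> V)
    (f : nat -> nat -> nat -> nat) : Prop :=
  exists (P : cmd) (T : nat -> nat -> nat -> nat),
    Ostar T f /\
    forall (F : fieldType) (r : nat) (V : vectType F) (mul : V -> V -> V)
           (e : r.-tuple V) (u : V) (k n : nat) (A : 'M[V]_(k, n)),
      is_algebra mul -> basis_of fullv e ->
      (k = 0%N -> left_id u mul /\ right_id u mul) ->
      exists (t : nat) (s : ram F),
        [/\ exec P (init_ram mul u e A) t s,
            (t <= T n k r)%N
          & mkseq (fmem s) r = coords e (g F V mul u k n A)].

(* Main.v *)
Require Import Defs.
From mathcomp Require Import all_boot all_order all_algebra all_fingroup.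
From mathcomp Require Import zify ring.
From Stdlib Require Import FunctionalExtensionality.

Set Implicit Arguments.
Unset Strict Implicit.
Unset Printing Implicit Defensive.

Import Order.TTheory GRing.Theory Num.Theory.
Local Open Scope nat_scope.

(** Expanding every entry of A in the basis turns both functions into a sum over
  the words w in [r]^k: the coefficient of e_(w_1) ... e_(w_k) is the rectangular
  permanent (determinant) of the scalar k x n matrix whose (i, j) entry is the
  coordinate of index w_i of A i j.  Such a scalar function is computed with
  2^k poly(n, k) operations by adding the columns one at a time, from the last to
  the first, and keeping, for every set S of rows, the sum over the injections of
  S into the columns seen so far, weighted for the determinant by (-1)^inversions.
  A new column matched to row i is smaller than the previous ones, so it creates
  one inversion for each row i' < i of S.  With the r^k products of basis vectors
  this costs O*(2^k r^k), which is within the bound. *)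

(** * A program logic with time *)

(** Words and masks are integers as large as r^k and 2^k, so integer operations are not free under
    logarithmic cost. One bound M on all registers, (n + k + r + 16)^(k + 1), settles this: its bit
    length is polynomial, expressions of bounded size keep it so, and only primitive steps remain to
    be counted. For the determinant the sign is attached to the injection itself, through its
    inversions, so that neither the image set nor its sorting permutation has to be known while
    columns are added; the parity of the inversions is identified with the sign of sigma separately.
    The boolean [q] treats both functions at once: the base of the sign is (-1)^q, which is 1 for
    the permanent. Products of basis vectors are formed from the left, starting at the first letter
    rather than at [u], which need not be an identity when k > 0. *)

Definition upd T (g : nat -> T) (x : nat) (v : T) : nat -> T :=
  [eta g with x |-> v].

Lemma updE T (g : nat -> T) x v y : upd g x v y = if y == x then v else g y.
Proof. by []. Qed.

Lemma upd_eq T (g : nat -> T) x v : upd g x v x = v.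
Proof. by rewrite updE eqxx. Qed.

Lemma upd_neq T (g : nat -> T) x v y : y != x -> upd g x v y = g y.
Proof. by rewrite updE => /negPf ->. Qed.

Lemma upd_upd T (g : nat -> T) x v v' : upd (upd g x v) x v' = upd g x v'.
Proof. by apply: functional_extensionality => y; rewrite !updE; case: eqP. Qed.

Lemma upd_id T (g : nat -> T) x v : g x = v -> upd g x v = g.
Proof.
by move=> <-; apply: functional_extensionality => y; rewrite updE; case: eqP => [->|].
Qed.

Lemma updC T (g : nat -> T) x y v v' :
  x != y -> upd (upd g x v) y v' = upd (upd g y v') x v.
Proof.
move=> nxy; apply: functional_extensionality => i; rewrite !updE.
by case: (i =P y) => [->|//]; rewrite eq_sym (negPf nxy).
Qed.

Lemma upd_nth L x (v : nat) : upd (nth 0 L) x v = nth 0 (set_nth 0 L x v).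
Proof. by apply: functional_extensionality => y; rewrite nth_set_nth updE. Qed.

Lemma ltn_exp_bitlen m : m < 2 ^ bitlen m.
Proof. exact: trunc_log_ltn. Qed.

Lemma bitlen_leq m p : m <= p -> bitlen m <= bitlen p.
Proof. by move=> h; rewrite ltnS; apply: leq_trunc_log. Qed.

Lemma bitlen_exp M s : bitlen (M ^ s) <= (s * bitlen M).+1.
Proof.
rewrite ltnS; case: s => [|s]; first by rewrite expn0.
have h : M ^ s.+1 < 2 ^ (s.+1 * bitlen M).
  by rewrite mulnC expnM ltn_exp2r // ltn_exp_bitlen.
have [->|Mgt0] := posnP M; first by rewrite exp0n.
have M_gt0 : 0 < M ^ s.+1 by rewrite expn_gt0 Mgt0.
rewrite -(leq_exp2l (m := 2)) //; apply: leq_trans (ltnW h).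
exact: trunc_logP.
Qed.

Fixpoint isize (e : iexp) : nat :=
  match e with
  | IConst _ => 1
  | ILoad a => (isize a).+1
  | IAdd a b | ISub a b | IMul a b | IDiv a b => (isize a + isize b).+1
  end.

Fixpoint fsize (e : fexp) : nat :=
  match e with
  | FZero | FOne => 1
  | FLoad a => (isize a).+1
  | FOpp x | FInv x => (fsize x).+1
  | FAdd x y | FMul x y => (fsize x + fsize y).+1
  end.

Fixpoint ismall (e : iexp) : bool :=
  match e with
  | IConst c => c <= 16
  | ILoad a => ismall a
  | IAdd a b | ISub a b | IMul a b | IDiv a b => ismall a && ismall b
  end.

Fixpoint fsmall (e : fexp) : bool :=
  match e with
  | FZero | FOne => true
  | FLoad a => ismall a
  | FOpp x | FInv x => fsmall x
  | FAdd x y | FMul x y => fsmall x && fsmall y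
  end.

(** * Cost of evaluating a bounded expression *)

Section Cost.
Variables (F : fieldType) (M : nat).
Hypothesis M_ge16 : 16 <= M.

Definition bnd (L : nat -> nat) := forall x, L x <= M.

Lemma bnd_upd L x v : bnd L -> v <= M -> bnd (upd L x v).
Proof. by move=> bL hv y; rewrite updE; case: eqP. Qed.

Lemma bnd_nth L : all (leq^~ M) L -> bnd (nth 0 L).
Proof.
move=> /all_nthP h x; have [/(h 0)//|lx] := ltnP x (size L).
by rewrite nth_default.
Qed.

Lemma isize_gt0 e : 0 < isize e. Proof. by case: e. Qed.

(** A load yields at most M, and every operation at most adds exponents, up to one extra factor M
    that absorbs a sum. This crude bound spares a separate analysis of each address. *)
Lemma ieval_bound (s : ram F) e :
  bnd (imem s) -> ismall e -> ieval s e <= M ^ isize e.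
Proof.
move=> bs; have M_ge2 : 2 <= M by apply: leq_trans M_ge16.
have M0 : 0 < M by apply: leq_trans M_ge2.
have h2 c d : 0 < c -> 0 < d -> M ^ c + M ^ d <= M ^ (c + d).+1.
  move=> c0 d0; rewrite expnS.
  have hc : M ^ c <= M ^ (c + d) by rewrite leq_exp2l // leq_addr.
  have hd : M ^ d <= M ^ (c + d) by rewrite leq_exp2l // leq_addl.
  by apply: leq_trans (leq_mul M_ge2 (leqnn _)); rewrite mul2n -addnn leq_add.
have hS c d : M ^ c <= M ^ (c + d).+1 by rewrite leq_exp2l // -addnS leq_addr.
elim: e => [c|a IH|a IHa b IHb|a IHa b IHb|a IHa b IHb|a IHa b IHb] //=.
- by move=> c2; rewrite expn1 (leq_trans c2).
- move=> ha; apply: leq_trans (bs _) _; rewrite expnS.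
  by rewrite leq_pmulr // expn_gt0 M0.
- case/andP=> /IHa ha /IHb hb; apply: leq_trans (leq_add ha hb) _.
  by rewrite h2 ?isize_gt0.
- case/andP=> /IHa ha _; apply: leq_trans (leq_subr _ _) _.
  exact: leq_trans ha (hS _ _).
- case/andP=> /IHa ha /IHb hb; apply: leq_trans (leq_mul ha hb) _.
  by rewrite -expnD leq_exp2l.
- case/andP=> /IHa ha _; apply: leq_trans (leq_div _ _) _.
  exact: leq_trans ha (hS _ _).
Qed.

Definition unit_cost (S : nat) : nat := (S * bitlen M).+1.

Lemma unit_cost_leq S S' : S <= S' -> unit_cost S <= unit_cost S'.
Proof. by move=> h; rewrite ltnS leq_mul2r h orbT. Qed.

(** [isize e] counts the nodes of [e], and no node has a value above M^(isize e). *)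
Lemma icost_bound (s : ram F) e :
  bnd (imem s) -> ismall e -> icost s e <= isize e * unit_cost (isize e).
Proof.
move=> bs se; have bev := ieval_bound bs se.
have bl e' : bnd (imem s) -> ismall e' -> bitlen (ieval s e') <= unit_cost (isize e').
  by move=> b' s'; apply: leq_trans (bitlen_leq (ieval_bound b' s')) (bitlen_exp _ _).
have bin a b : icost s a <= isize a * unit_cost (isize a) ->
    icost s b <= isize b * unit_cost (isize b) ->
    icost s a + icost s b <=
    (isize a + isize b) * unit_cost (isize a + isize b).+1.
  move=> ha hb; rewrite mulnDl; apply: leq_add.
  - by apply: leq_trans ha _; rewrite leq_mul2l unit_cost_leq ?orbT // -addnS leq_addr.
  - by apply: leq_trans hb _; rewrite leq_mul2l unit_cost_leq ?orbT // -addSn leq_addl.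
elim: e se {bev} => [c|a IH|a IHa b IHb|a IHa b IHb|a IHa b IHb|a IHa b IHb] se;
  have := bl _ bs se; rewrite /= mulSn => h; apply: leq_add h _ => //.
- by apply: leq_trans (IH se) _; rewrite leq_mul2l unit_cost_leq ?orbT.
all: by case/andP: se => sa sb; apply: bin; [apply: IHa|apply: IHb].
Qed.

Lemma fcost_bound (s : ram F) e :
  bnd (imem s) -> fsmall e -> fcost s e <= fsize e * unit_cost (fsize e).
Proof.
move=> bs.
have u0 S : 0 < unit_cost S by [].
have bin a b : fcost s a <= fsize a * unit_cost (fsize a) ->
    fcost s b <= fsize b * unit_cost (fsize b) ->
    (fcost s a + fcost s b).+1 <=
    (fsize a + fsize b).+1 * unit_cost (fsize a + fsize b).+1.
  move=> ha hb; rewrite mulSn -add1n leq_add // mulnDl; apply: leq_add.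
  - by apply: leq_trans ha _; rewrite leq_mul2l unit_cost_leq ?orbT // -addnS leq_addr.
  - by apply: leq_trans hb _; rewrite leq_mul2l unit_cost_leq ?orbT // -addSn leq_addl.
elim: e => [||a|a IH|a IHa b IHb|a IHa b IHb|a IH] //= se.
- rewrite mulSn -add1n leq_add //; apply: leq_trans (icost_bound bs se) _.
  by rewrite leq_mul2l unit_cost_leq ?orbT.
- rewrite mulSn -add1n leq_add //; apply: leq_trans (IH se) _.
  by rewrite leq_mul2l unit_cost_leq ?orbT.
- by case/andP: se => sa sb; apply: bin; [apply: IHa|apply: IHb].
- by case/andP: se => sa sb; apply: bin; [apply: IHa|apply: IHb].
- rewrite mulSn -add1n leq_add //; apply: leq_trans (IH se) _.
  by rewrite leq_mul2l unit_cost_leq ?orbT.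
Qed.

End Cost.

(* Exceeds the size of every expression of the program below; likewise 16 in
   [ismall] exceeds its integer constants, register addresses included. *)
Definition max_size : nat := 200.

Definition small_iexp (e : iexp) : bool := ismall e && (isize e <= max_size).
Definition small_fexp (e : fexp) : bool := fsmall e && (fsize e <= max_size).

(** A store or a comparison evaluates two expressions, hence the two equal summands. *)
Definition step_cost (M : nat) : nat :=
  (max_size * unit_cost M max_size + max_size * unit_cost M max_size).+1.

Definition Rg (x : nat) : iexp := ILoad (IConst x).
Definition IInc (e : iexp) : iexp := IAdd e (IConst 1).

(* The counter is reset on exit, so that a loop leaves the integer registers as
   it found them. *)
Definition For (x : nat) (b : iexp) (c : cmd) : cmd :=
  Seq (While (TLe (IInc (Rg x)) b) (Seq c (IStore (IConst x) (IInc (Rg x)))))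
      (IStore (IConst x) (IConst 0)).

Definition Pow (y z : nat) (b e : iexp) : cmd :=
  Seq (IStore (IConst y) (IConst 1))
      (For z e (IStore (IConst y) (IMul (Rg y) b))).

(** * Timed rules for commands and loops *)

Section Hoare.
Variables (F : fieldType) (M : nat).
Hypothesis M_ge16 : 16 <= M.
Local Notation fmemory := (nat -> F).
Local Notation B := (step_cost M).

(* Integer registers are tracked exactly and the field memory by assertions;
   time is counted in steps of cost at most [step_cost M]. *)
Definition hoare (t : nat) (L : nat -> nat) (P : fmemory -> Prop) (c : cmd)
    (L' : nat -> nat) (Q : fmemory -> Prop) : Prop :=
  forall f, P f -> exists f' t',
    [/\ exec c (Ram L f) t' (Ram L' f'), t' <= t * B & Q f'].

Lemma cost2 S1 S2 : S1 <= max_size -> S2 <= max_size ->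
  (S1 * unit_cost M S1 + S2 * unit_cost M S2).+1 <= B.
Proof.
by move=> h1 h2; rewrite ltnS leq_add // leq_mul // unit_cost_leq.
Qed.

Lemma hoare_conseq t L P c L' Q t' (P' Q' : fmemory -> Prop) :
  hoare t L P c L' Q -> t <= t' -> (forall f, P' f -> P f) ->
  (forall f, Q f -> Q' f) -> hoare t' L P' c L' Q'.
Proof.
move=> h tt' hP hQ f /hP /h [f' [u [hu ut hf']]]; exists f', u; split=> //.
  by apply: leq_trans ut _; rewrite leq_mul2r tt' orbT.
exact: hQ.
Qed.

Lemma hoare_seq t1 t2 L L1 L2 P R Q c1 c2 :
  hoare t1 L P c1 L1 R -> hoare t2 L1 R c2 L2 Q ->
  hoare (t1 + t2) L P (Seq c1 c2) L2 Q.
Proof.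
move=> h1 h2 f /h1 [f1 [u1 [e1 b1 /h2 [f2 [u2 [e2 b2 q]]]]]].
exists f2, (u1 + u2); split=> //; first exact: exec_seq e1 e2.
by rewrite mulnDl leq_add.
Qed.

Lemma hoare_istore L L' (P : fmemory -> Prop) x e v :
  bnd M L -> x <= 16 -> small_iexp e ->
  (forall f : fmemory, ieval (Ram L f) e = v) -> upd L x v = L' ->
  hoare 1 L P (IStore (IConst x) e) L' P.
Proof.
move=> bL x16 /andP[se ze] ev <- f Pf; rewrite -(ev f).
exists f; eexists; split; [exact: (exec_istore (IConst x) e (Ram L f)) | | by []].
rewrite mul1n; apply: leq_trans (cost2 (isT : 1 <= max_size) ze).
rewrite ltnS leq_add //.
  exact: (icost_bound M_ge16 (s := Ram L f) (e := IConst x)).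
exact: icost_bound.
Qed.

Lemma hoare_fstore L (P Q : fmemory -> Prop) a x :
  bnd M L -> small_iexp a -> small_fexp x ->
  (forall f, P f -> Q (upd f (ieval (Ram L f) a) (feval (Ram L f) x))) ->
  hoare 1 L P (FStore a x) L Q.
Proof.
move=> bL /andP[sa za] /andP[sx zx] h f Pf.
eexists; eexists; split; [exact: exec_fstore | | exact: h].
rewrite mul1n; apply: leq_trans (cost2 za zx).
by rewrite ltnS leq_add ?icost_bound ?fcost_bound.
Qed.

Lemma tcost_le L (f : fmemory) a b :
  bnd M L -> small_iexp a -> small_iexp b -> tcost (Ram L f) (TLe a b) <= B.
Proof.
move=> bL /andP[sa za] /andP[sb zb] /=; apply: leq_trans (cost2 za zb).
by rewrite ltnS leq_add ?icost_bound.
Qed.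

(** Freezing the initial memory as [g] lets a postcondition say that the cells outside the working
    area still agree with it. *)
Lemma hoare_ghost t L (P Q : fmemory -> Prop) c L' :
  (forall g, P g -> hoare t L (eq g) c L' Q) -> hoare t L P c L' Q.
Proof. by move=> h f Pf; apply: (h f). Qed.

Lemma hoare_skip L P : hoare 1 L P Skip L P.
Proof. by move=> f Pf; exists f, 1; split=> //; apply: exec_skip. Qed.

Lemma hoare_if t L L' P Q a b c1 c2 (d : bool) :
  bnd M L -> small_iexp a -> small_iexp b ->
  (forall f : fmemory, (ieval (Ram L f) a <= ieval (Ram L f) b) = d) ->
  hoare t L P (if d then c1 else c2) L' Q ->
  hoare t.+1 L P (If (TLe a b) c1 c2) L' Q.
Proof.
move=> bL sa sb hd h f Pf; have [f' [u [eu bu q]]] := h f Pf.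
exists f', (tcost (Ram L f) (TLe a b) + u); split=> //.
  by apply: exec_if; rewrite /teval hd.
by rewrite mulSn leq_add ?tcost_le.
Qed.

Lemma small_inc x : x <= 16 -> small_iexp (IInc (Rg x)).
Proof. by move=> hx; rewrite /small_iexp /= hx. Qed.

(** [L i] and [L' i] are the registers before and after the body of round i. Both are families
    because the body of [Pow] changes a register in each round. *)
Lemma hoare_for_gen t N (L L' : nat -> nat -> nat) Lf (I : nat -> fmemory -> Prop) x b c :
  x <= 16 -> small_iexp b ->
  (forall i, i <= N -> bnd M (L i)) ->
  (forall i, i < N -> bnd M (L' i)) ->
  (forall i, i <= N -> L i x = i) ->
  (forall i, i < N -> upd (L' i) x (L' i x).+1 = L i.+1) ->
  Lf = upd (L N) x 0 ->
  (forall i (f : fmemory), i <= N -> ieval (Ram (L i) f) b = N) ->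
  (forall i, i < N -> hoare t (L i) (I i) c (L' i) (I i.+1)) ->
  hoare (N * (t + 2) + 2) (L 0) (I 0) (For x b c) Lf (I N).
Proof.
move=> x16 sb bL bL' Lx LL -> hb hc.
have sx := small_inc x16.
have -> : N * (t + 2) + 2 = N * (t + 2) + 1 + 1 by lia.
apply: (hoare_seq (L1 := L N) (R := I N)); last first.
  by apply: (hoare_istore (v := 0)) => //; apply: bL.
have main m i : i + m = N ->
    hoare (m * (t + 2) + 1) (L i) (I i)
      (While (TLe (IInc (Rg x)) b) (Seq c (IStore (IConst x) (IInc (Rg x)))))
      (L N) (I N).
  elim: m i => [|m IH] i iN f If.
    have -> : i = N by lia.
    exists f; eexists; split; [apply: exec_while_false | | by have <- : i = N by lia].
      by rewrite /= Lx // hb //; lia.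
    by rewrite mul1n; apply: tcost_le => //; apply: bL.
  have iN' : i < N by lia.
  have body : hoare (t + 1) (L i) (I i) (Seq c (IStore (IConst x) (IInc (Rg x))))
                 (L i.+1) (I i.+1).
    apply: hoare_seq (hc i iN') _; rewrite -(LL i iN').
    apply: (hoare_istore (v := (L' i x).+1)) => //; first exact: bL'.
    by move=> g /=; rewrite addn1.
  have [f1 [u1 [e1 b1 I1]]] := body f If.
  have iN1 : i.+1 + m = N by lia.
  have [f2 [u2 [e2 b2 I2]]] := IH i.+1 iN1 f1 I1.
  exists f2; eexists; split; [apply: exec_while_true e1 e2 | | exact: I2].
    by rewrite /= Lx ?hb //; lia.
  have := tcost_le f (bL i (ltnW iN')) sx sb.
  by move: b1 b2; set tc := tcost _ _; nia.
exact: main.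
Qed.

Lemma hoare_for t N L Lx (I : nat -> fmemory -> Prop) x b c :
  x <= 16 -> small_iexp b -> bnd M L -> N <= M -> L x = 0 ->
  (forall i, upd L x i = Lx i) ->
  (forall i (f : fmemory), ieval (Ram (Lx i) f) b = N) ->
  (forall i, i < N -> hoare t (Lx i) (I i) c (Lx i) (I i.+1)) ->
  hoare (N * (t + 2) + 2) L (I 0) (For x b c) L (I N).
Proof.
move=> x16 sb bL NM Lx0 LxE hb hc; rewrite -{1}(upd_id Lx0).
apply: (hoare_for_gen (L := fun i => upd L x i) (L' := fun i => upd L x i)) => //.
- by move=> i iN; apply: bnd_upd => //; lia.
- by move=> i iN; apply: bnd_upd => //; lia.
- by move=> i _; rewrite upd_eq.
- by move=> i _; rewrite upd_eq upd_upd.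
- by rewrite upd_upd upd_id.
- by move=> i f _; rewrite LxE.
- by move=> i; rewrite LxE; apply: hc.
Qed.

(** Every intermediate power is bounded, since the last one does not bound the others when [vb = 0].
    The limit 100 on the size of [b] leaves room for the multiplication within [max_size]. *)
Lemma hoare_pow L L' (P : fmemory -> Prop) y z b e vb ve :
  bnd M L -> y <= 16 -> z <= 16 -> y != z -> L z = 0 ->
  small_iexp b -> small_iexp e -> isize b <= 100 ->
  (forall i, i <= ve -> vb ^ i <= M) -> ve <= M ->
  (forall p i (f : fmemory), ieval (Ram (upd (upd L y p) z i) f) b = vb) ->
  (forall p i (f : fmemory), ieval (Ram (upd (upd L y p) z i) f) e = ve) ->
  upd L y (vb ^ ve) = L' ->
  hoare (3 * ve + 3) L P (Pow y z b e) L' P.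
Proof.
move=> bL y16 z16 yz Lz sb se szb pM veM hb he <-.
have M1 : 1 <= M by apply: leq_trans M_ge16.
apply: (hoare_conseq (t := 1 + (ve * (1 + 2) + 2)) (P := P) (Q := P)) => //; last first.
  by lia.
apply: (hoare_seq (L1 := upd L y 1) (R := P)).
  exact: (hoare_istore (v := 1)).
have -> : upd L y 1 = upd (upd L y (vb ^ 0)) z 0.
  by rewrite [RHS]upd_id ?expn0 // upd_neq // eq_sym.
apply: (hoare_for_gen (L := fun i => upd (upd L y (vb ^ i)) z i)
          (L' := fun i => upd (upd L y (vb ^ i.+1)) z i) (I := fun _ => P)) => //.
- by move=> i ive; do 2?apply: bnd_upd => //; [apply: pM|lia].
- by move=> i ive; do 2?apply: bnd_upd => //; [apply: pM|lia].
- by move=> i ive; rewrite upd_eq.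
- by move=> i ive; rewrite upd_eq upd_upd.
- by rewrite upd_upd [RHS]upd_id // upd_neq // eq_sym.
- move=> i ive.
  have -> : upd (upd L y (vb ^ i.+1)) z i = upd (upd (upd L y (vb ^ i)) z i) y (vb ^ i.+1).
    by rewrite [RHS]updC 1?eq_sym // upd_upd.
  apply: (hoare_istore (v := vb ^ i.+1)) => //.
  + by do 2?apply: bnd_upd => //; [apply: pM; lia|lia].
  + by case/andP: sb => sb _; rewrite /small_iexp /= y16 sb /max_size; lia.
  + by move=> f /=; rewrite hb upd_neq // upd_eq mulnC -expnS.
Qed.

End Hoare.

(** * The program and its correctness *)

Definition bit (m i : nat) : bool := odd (m %/ 2 ^ i).
(** A word of length k is coded by a number w < r^k, its letters being the base-r digits, least
    significant first. *)
Definition digit (r w i : nat) : nat := (w %/ r ^ i) %% r.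

Lemma bit_leq m i : bit m i -> 2 ^ i <= m.
Proof. by rewrite /bit; case: leqP => // h; rewrite divn_small. Qed.

(** The machine has no remainder operation; this identity justifies [imod]. *)
Lemma subn_div_mul x d : x - x %/ d * d = x %% d.
Proof. by rewrite {1}(divn_eq x d) addKn. Qed.

Section Spec.
Variables (F : fieldType) (q : bool) (n k r : nat).
Local Notation sg := ((-1) ^+ q : F)%R.

Definition dp_term (a : nat -> nat -> F) (j m : nat) (prev : nat -> F) (i : nat) : F :=
  (sg ^+ (\sum_(0 <= i' < i) bit m i') * (a i (n - j.+1)%N * prev (m - 2 ^ i)%N))%R.

(* [dp a j m]: signed sum over the injections of the row set of mask m into the
   last j columns. *)
Fixpoint dp (a : nat -> nat -> F) (j m : nat) : F :=
  if j is j'.+1 then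
    (dp a j' m + \sum_(0 <= i < k | bit m i) dp_term a j' m (dp a j') i)%R
  else (m == 0)%:R%R.

Definition entry_addr (i j : nat) : nat := r * r * r + r + (i * n + j) * r.

Definition word_entry (f : nat -> F) (w i j : nat) : F :=
  f (entry_addr i j + digit r w i).

(** Coordinate l of the product of the basis vectors of letters 0 to i. The cell at (a * r + d) * r
    + l holds coordinate l of the product of the basis vectors a and d; for k = 0 the value is read
    from [u], stored after these cells. *)
Fixpoint word_vec (f : nat -> F) (w i l : nat) : F :=
  if i is i'.+1 then
    (\sum_(0 <= a < r)
      word_vec f w i' a * f ((a * r + digit r w i) * r + l)%N)%R
  else if k == 0 then f (r * r * r + l) else (l == digit r w 0)%:R%R.

Definition word_sum (f : nat -> F) (R l : nat) : F :=
  (\sum_(0 <= w < R)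
     dp (word_entry f w) n (2 ^ k).-1 * word_vec f w k.-1 l)%R.

End Spec.

(* Registers: 0-2 hold n, k, r; 3-4 hold r^k and 2^k; 5 the word w; 6 the column
   counter j; 7 the mask counter and 8 the mask m; 9 the row i; 10-11 hold 2^i and
   a power of r; 12-13 the coordinates l and a; 14 is the counter of [Pow].
   Field memory: the input is followed by the accumulated result (e_out), the
   current product of basis vectors (e_vec), a scratch vector (e_tmp), the running
   sign (e_sgn) and the table of [dp], indexed by masks. *)
Definition imod (x d : iexp) : iexp := ISub x (IMul (IDiv x d) d).
Definition e_r3 : iexp := IMul (IMul (Rg 2) (Rg 2)) (Rg 2).
Definition e_mat : iexp := IAdd e_r3 (Rg 2).
Definition e_out : iexp := IAdd e_mat (IMul (IMul (Rg 1) (Rg 0)) (Rg 2)).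
Definition e_vec : iexp := IAdd e_out (Rg 2).
Definition e_tmp : iexp := IAdd e_vec (Rg 2).
Definition e_sgn : iexp := IAdd e_tmp (Rg 2).
Definition e_dp (m : iexp) : iexp := IAdd (IInc e_sgn) m.
Definition e_digit : iexp := imod (IDiv (Rg 5) (Rg 11)) (Rg 2).
Definition e_entry : iexp :=
  IAdd (IAdd e_mat
    (IMul (IAdd (IMul (Rg 9) (Rg 0)) (ISub (Rg 0) (IInc (Rg 6)))) (Rg 2))) e_digit.

Definition dp_row (q : bool) : cmd :=
  Seq (Pow 10 14 (IConst 2) (Rg 9))
 (Seq (If (TLe (IConst 1) (imod (IDiv (Rg 8) (Rg 10)) (IConst 2)))
        (Seq (Pow 11 14 (Rg 2) (Rg 9))
        (Seq (FStore (e_dp (Rg 8))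
                (FAdd (FLoad (e_dp (Rg 8)))
                   (FMul (FLoad e_sgn)
                      (FMul (FLoad e_entry) (FLoad (e_dp (ISub (Rg 8) (Rg 10))))))))
        (Seq (FStore e_sgn (if q then FOpp (FLoad e_sgn) else FLoad e_sgn))
             (IStore (IConst 11) (IConst 0)))))
        Skip)
      (IStore (IConst 10) (IConst 0))).

Definition dp_mask (q : bool) : cmd :=
  Seq (IStore (IConst 8) (ISub (Rg 4) (IInc (Rg 7))))
 (Seq (FStore e_sgn FOne)
 (Seq (For 9 (Rg 1) (dp_row q))
      (IStore (IConst 8) (IConst 0)))).

Definition dp_cmd (q : bool) : cmd :=
  Seq (For 7 (Rg 4) (FStore (e_dp (Rg 7)) FZero))
 (Seq (FStore (e_dp (IConst 0)) FOne)
      (For 6 (Rg 0) (For 7 (Rg 4) (dp_mask q)))).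

Definition first_vec : cmd :=
  If (TLe (Rg 1) (IConst 0))
    (For 12 (Rg 2) (FStore (IAdd e_vec (Rg 12)) (FLoad (IAdd e_r3 (Rg 12)))))
    (Seq (For 12 (Rg 2) (FStore (IAdd e_vec (Rg 12)) FZero))
         (FStore (IAdd e_vec (imod (Rg 5) (Rg 2))) FOne)).

(** Each new coordinate depends on all the old ones, so the product is built in the scratch vector
    and then copied back. *)
Definition next_vec : cmd :=
  Seq (Pow 11 14 (Rg 2) (IInc (Rg 9)))
 (Seq (For 12 (Rg 2)
        (Seq (FStore (IAdd e_tmp (Rg 12)) FZero)
             (For 13 (Rg 2)
               (FStore (IAdd e_tmp (Rg 12))
                  (FAdd (FLoad (IAdd e_tmp (Rg 12)))
                     (FMul (FLoad (IAdd e_vec (Rg 13)))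
                        (FLoad (IAdd (IMul (IAdd (IMul (Rg 13) (Rg 2)) e_digit) (Rg 2))
                                  (Rg 12)))))))))
 (Seq (For 12 (Rg 2) (FStore (IAdd e_vec (Rg 12)) (FLoad (IAdd e_tmp (Rg 12)))))
      (IStore (IConst 11) (IConst 0)))).

Definition vec_cmd : cmd :=
  Seq first_vec (For 9 (ISub (Rg 1) (IConst 1)) next_vec).

Definition word_cmd (q : bool) : cmd :=
  Seq (dp_cmd q)
 (Seq vec_cmd
      (For 12 (Rg 2)
        (FStore (IAdd e_out (Rg 12))
           (FAdd (FLoad (IAdd e_out (Rg 12)))
              (FMul (FLoad (e_dp (ISub (Rg 4) (IConst 1))))
                 (FLoad (IAdd e_vec (Rg 12)))))))).

(** The result is accumulated beyond the input and moved only at the end, because cells 0 to r-1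
    hold structure constants that every word needs. *)
Definition main_cmd (q : bool) : cmd :=
  Seq (Pow 3 14 (Rg 2) (Rg 1))
 (Seq (Pow 4 14 (IConst 2) (Rg 1))
 (Seq (For 5 (Rg 3) (word_cmd q))
      (For 12 (Rg 2) (FStore (Rg 12) (FLoad (IAdd e_out (Rg 12))))))).

Section Correct.
Variables (F : fieldType) (M : nat) (q : bool) (n k r : nat) (f0 : nat -> F).
Hypothesis M_ge16 : 16 <= M.
Hypothesis nM : n <= M.
Hypothesis kM : k.+1 <= M.
Hypothesis rM : r <= M.
Hypothesis pow2M : forall i, i <= k -> 2 ^ i <= M.
Hypothesis powrM : forall i, i <= k -> r ^ i <= M.
Local Notation hoare := (@hoare F M).
Local Notation sg := ((-1) ^+ q : F)%R.
Local Notation R := (r ^ k).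
Local Notation K := (2 ^ k).

Definition out_addr := r * r * r + r + k * n * r.
Local Notation O := out_addr.

(** Register 14 is not listed: [nth] gives it the default 0, its value whenever [Pow] is not
    running. *)
Definition regs (R K w j s m i p2 pr l a : nat) : nat -> nat :=
  nth 0 [:: n; k; r; R; K; w; j; s; m; i; p2; pr; l; a].

Ltac regs_eq := by move=> *; rewrite /regs upd_nth.
Ltac bnd := by apply: bnd_nth; rewrite /=; lia.

Section Word.
Variable w : nat.
Hypothesis wM : w < R.
Local Notation dp := (@dp F q n k (word_entry n r f0 w)).
Local Notation dpt := (@dp_term F q n (word_entry n r f0 w)).

Let RM : R <= M. Proof. exact: powrM. Qed.
Let KM : K <= M. Proof. exact: pow2M. Qed.

(** * The table over sets of rows *)

Section Dp.
Variable g : nat -> F.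
Hypothesis gf0 : forall x, x < O -> g x = f0 x.

Local Notation D := (O + r + r + r).
Definition below_dp (f : nat -> F) := forall x, x < D -> f x = g x.

(** The table is overwritten in place. The update of mask m reads only m and smaller masks m - 2^i,
    all at stage j, so masks are visited in decreasing order: those above m are at stage j+1, those
    below at stage j, and cell m holds a partial sum. *)
Definition row_inv (j m i : nat) (f : nat -> F) : Prop :=
  [/\ below_dp f,
      f D = (sg ^+ (\sum_(0 <= i' < i) bit m i'))%R,
      f (D.+1 + m) = (dp j m + \sum_(0 <= i' < i | bit m i') dpt j m (dp j) i')%R,
      forall m', m' < m -> f (D.+1 + m') = dp j m'
    & forall m', m < m' < K -> f (D.+1 + m') = dp j.+1 m'].

Lemma entry_addr_lt i j d : i < k -> j < n -> d < r -> entry_addr n r i j + d < O.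
Proof.
move=> ik jn dr; rewrite /entry_addr /out_addr -!addnA ltn_add2l ltn_add2l.
have h : (i * n + j).+1 * r <= k * n * r.
  by rewrite leq_mul2r; apply/orP; right; nia.
by apply: leq_trans h; rewrite mulSn addnC ltn_add2r.
Qed.

Lemma dp_rowP j s m i : i < k -> j < n -> m < K -> s < K ->
  hoare (6 * k + 12) (regs R K w j s m i 0 0 0 0) (row_inv j m i) (dp_row q)
    (regs R K w j s m i 0 0 0 0) (row_inv j m i.+1).
Proof.
move=> ik jn mK sK.
have p2i : 2 ^ i <= M by apply: pow2M; lia.
have pri : r ^ i <= M by apply: powrM; lia.
(* A word exists and k > i >= 0, so r = 0 is excluded and digits are below r. *)
have r0 : 0 < r by move: wM; case: (posnP r) => // ->; rewrite exp0n //; lia.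
apply: (hoare_conseq (t := (3 * i + 3) + ((3 * i + 3 + (1 + (1 + 1))).+1 + 1))
  (P := row_inv j m i) (Q := row_inv j m i.+1)) => //; last by lia.
apply: (hoare_seq (L1 := regs R K w j s m i (2 ^ i) 0 0 0) (R := row_inv j m i)).
  apply: (hoare_pow M_ge16 (vb := 2) (ve := i)) => //; [bnd| |lia|by regs_eq].
  by move=> i' hi'; apply: pow2M; lia.
apply: (hoare_seq (L1 := regs R K w j s m i (2 ^ i) 0 0 0) (R := row_inv j m i.+1)); last first.
  by apply: (hoare_istore M_ge16 (v := 0)) => //; [bnd | regs_eq].
apply: (hoare_if M_ge16 (d := bit m i)) => //; first bnd.
  by move=> f /=; rewrite subn_div_mul modn2 lt0b.
case: ifP => bmi; last first.
  apply: (hoare_conseq (@hoare_skip F M _ (row_inv j m i))) => //; first by lia.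
  move=> f [h1 h2 h3 h4 h5]; split=> //.
    by rewrite big_nat_recr //= bmi addn0.
  by rewrite big_mkcond big_nat_recr //= bmi addr0 -big_mkcond.
have im := bit_leq bmi.
apply: (hoare_seq (L1 := regs R K w j s m i (2 ^ i) (r ^ i) 0 0) (R := row_inv j m i)).
  apply: (hoare_pow M_ge16 (vb := r) (ve := i)) => //; [bnd| |lia|by regs_eq].
  by move=> i' hi'; apply: powrM; lia.
(* The invariant for i+1 holds only after both the table cell and the sign are stored, so the
   intermediate assertion is the precondition of the sign update. *)
apply: (hoare_seq (L1 := regs R K w j s m i (2 ^ i) (r ^ i) 0 0)
  (R := fun f => row_inv j m i.+1 (upd f D (sg * f D)%R))).
  apply: (hoare_fstore M_ge16) => //; first bnd.
  move=> f [h1 h2 h3 h4 h5]; rewrite /regs /= -/O subn_div_mul.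
  have two0 : 0 < 2 ^ i by rewrite expn_gt0.
  split.
  - by move=> x xD; rewrite !upd_neq ?h1 //; lia.
  - rewrite upd_eq upd_neq; last by lia.
    by rewrite h2 big_nat_recr //= bmi addn1 exprS.
  - rewrite upd_neq; last by lia.
    rewrite addn1 upd_eq h3 [in RHS]big_mkcond big_nat_recr //= -big_mkcond /= bmi -addrA.
    congr (_ + (_ + _))%R; rewrite /dp_term h2 h4; last by lia.
    congr (_ * (_ * _))%R.
    rewrite addn1 h1; last first.
      apply: leq_trans (entry_addr_lt (j := n - j.+1) ik _ (ltn_pmod _ r0)) _; lia.
    rewrite gf0 //; apply: entry_addr_lt => //; [lia|by rewrite ltn_pmod].
  - by move=> m' mm'; rewrite !upd_neq ?h4 //; lia.
  - by move=> m' mm'; rewrite !upd_neq ?h5 //; lia.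
apply: (hoare_seq (L1 := regs R K w j s m i (2 ^ i) (r ^ i) 0 0) (R := row_inv j m i.+1)); last first.
  by apply: (hoare_istore M_ge16 (v := 0)) => //; [bnd | regs_eq].
apply: (hoare_fstore M_ge16) => //; [bnd| by case: q |].
move=> f; rewrite /= -/O; suff -> : feval (Ram (regs R K w j s m i (2 ^ i) (r ^ i) 0 0) f)
  (if q then FOpp (FLoad e_sgn) else FLoad e_sgn) = (sg * f D)%R by [].
by case: q; rewrite /= ?expr1 ?mulN1r ?expr0 ?mul1r.
Qed.

Definition mask_inv (j c : nat) (f : nat -> F) : Prop :=
  below_dp f /\
  forall m, m < K -> f (D.+1 + m) = dp (if m < K - c then j else j.+1) m.

Lemma dp_maskP j c : c < K -> j < n ->
  hoare (6 * (k + 3) ^ 2) (regs R K w j c 0 0 0 0 0 0) (mask_inv j c) (dp_mask q)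
    (regs R K w j c 0 0 0 0 0 0) (mask_inv j c.+1).
Proof.
(* The counter c runs upwards, so the masks run downwards from K - 1. *)
move=> cK jn; pose m := K - c.+1.
have mK : m < K by rewrite /m; lia.
apply: (hoare_conseq (t := 1 + (1 + (k * ((6 * k + 12) + 2) + 2 + 1)))
  (P := mask_inv j c) (Q := mask_inv j c.+1)) => //; last by nia.
apply: (hoare_seq (L1 := regs R K w j c m 0 0 0 0 0) (R := mask_inv j c)).
  apply: (hoare_istore M_ge16 (v := m)) => //; [bnd| |by regs_eq].
  by move=> f /=; rewrite addn1.
apply: (hoare_seq (L1 := regs R K w j c m 0 0 0 0 0) (R := row_inv j m 0)).
  apply: (hoare_fstore M_ge16) => //; first bnd.
  move=> f [h1 h2]; rewrite /regs /= -/O; split.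
  - by move=> x xD; rewrite upd_neq ?h1 //; lia.
  - by rewrite upd_eq big_geq.
  - rewrite upd_neq; last by lia.
    by rewrite [in RHS]big_geq // addr0 h2 // ifT // /m; lia.
  - by move=> m' mm'; rewrite upd_neq ?h2 ?ifT //; lia.
  - by move=> m' mm'; rewrite upd_neq ?h2 ?ifF //; lia.
apply: (hoare_seq (L1 := regs R K w j c m 0 0 0 0 0) (R := mask_inv j c.+1)); last first.
  by apply: (hoare_istore M_ge16 (v := 0)) => //; [bnd | regs_eq].
apply: (hoare_conseq (t := k * (6 * k + 12 + 2) + 2) (P := row_inv j m 0) (Q := row_inv j m k)) => //; last first.
  move=> f [h1 h2 h3 h4 h5]; split=> // m' m'K.
  case: (ltngtP m' m) => mm'.
  - by rewrite h4 // ifT //; rewrite /m in mm'; lia.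
  - by rewrite h5 ?mm' // ifF //; rewrite /m in mm'; lia.
  - by rewrite mm' h3 ?ltnn ?ifF // /m; lia.
apply: (hoare_for M_ge16 (Lx := fun i => regs R K w j c m i 0 0 0 0)
   (I := row_inv j m)) => //; [bnd|lia|by regs_eq|].
by move=> i ik; apply: dp_rowP.
Qed.

Definition dp_time := K * 3 + 2 + (1 + (n * ((K * (6 * (k + 3) ^ 2 + 2) + 2) + 2) + 2)).

Lemma dp_cmdP :
  hoare dp_time (regs R K w 0 0 0 0 0 0 0 0) below_dp (dp_cmd q)
    (regs R K w 0 0 0 0 0 0 0 0)
    (fun f => below_dp f /\ f (D + K) = dp n K.-1).
Proof.
have K0 : 0 < K by rewrite expn_gt0.
apply: (hoare_seq (L1 := regs R K w 0 0 0 0 0 0 0 0)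
  (R := fun f => below_dp f /\ forall m, m < K -> f (D.+1 + m) = 0%R)).
  apply: (hoare_conseq (t := K * 3 + 2) (P := fun f => below_dp f /\ forall m, m < 0 -> f (D.+1 + m) = 0%R)
     (Q := fun f => below_dp f /\ forall m, m < K -> f (D.+1 + m) = 0%R)) => //.
  apply: (hoare_for (t := 1) M_ge16 (Lx := fun s => regs R K w 0 s 0 0 0 0 0 0)
    (I := fun s f => below_dp f /\ forall m, m < s -> f (D.+1 + m) = 0%R)) => //;
    [bnd|by regs_eq|].
  move=> s sK; apply: (hoare_fstore M_ge16) => //; first bnd.
  move=> f [h1 h2]; rewrite /regs /= -/O; split.
    by move=> x xD; rewrite upd_neq ?h1 //; lia.
  move=> m ms; rewrite updE; case: eqP => // ne; apply: h2; lia.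
apply: (hoare_seq (L1 := regs R K w 0 0 0 0 0 0 0 0) (R := mask_inv 0 0)).
  apply: (hoare_fstore M_ge16) => //; first bnd.
  move=> f [h1 h2]; rewrite /regs /= -/O; split.
    by move=> x xD; rewrite upd_neq ?h1 //; lia.
  move=> m ms; rewrite subn0 ms updE addn1 addn0 -[X in _ == X]addn0 eqn_add2l /=.
  by case: (m =P 0) => // _; apply: h2.
apply: (hoare_conseq (t := n * ((K * (6 * (k + 3) ^ 2 + 2) + 2) + 2) + 2) (P := mask_inv 0 0) (Q := mask_inv n 0)) => //; last first.
  (* The sign occupies cell D and the table starts at D + 1, so the full mask K - 1 sits at D +
     K. *)
  move=> f [h1 h2]; split=> //; have -> : D + K = D.+1 + K.-1 by lia.
  by rewrite h2 ?ifT //; lia.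
apply: (hoare_for M_ge16 (Lx := fun j => regs R K w j 0 0 0 0 0 0 0)
    (I := fun j => mask_inv j 0)) => //; [bnd|by regs_eq|].
move=> j jn.
apply: (hoare_conseq (t := K * (6 * (k + 3) ^ 2 + 2) + 2) (P := mask_inv j 0) (Q := mask_inv j K)) => //; last first.
  (* After K masks the whole table is at stage j+1, as required at the start of the next column. *)
  by move=> f [h1 h2]; split=> // m mK; rewrite h2 // subnn subn0 mK.
apply: (hoare_for M_ge16 (Lx := fun s => regs R K w j s 0 0 0 0 0 0)
    (I := fun c => mask_inv j c)) => //; [bnd|by regs_eq|].
by move=> c cK; apply: dp_maskP.
Qed.

End Dp.

(** * Products of basis vectors *)

Section Vec.
Variable g : nat -> F.
Hypothesis gf0 : forall x, x < O -> g x = f0 x.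

Local Notation vec := (word_vec k r f0 w).
Definition off_vec (f : nat -> F) :=
  forall x, ~~ (O + r <= x < O + r + r + r) -> f x = g x.

Definition vec_inv (i : nat) (f : nat -> F) : Prop :=
  off_vec f /\ forall l, l < r -> f (O + r + l) = vec i l.

Let out_addr_ge : r * r * r + r <= O. Proof. exact: leq_addr. Qed.

Lemma first_vecP :
  hoare (r * 3 + 4) (regs R K w 0 0 0 0 0 0 0 0) off_vec first_vec
    (regs R K w 0 0 0 0 0 0 0 0) (vec_inv 0).
Proof.
apply: (hoare_conseq (t := (r * (1 + 2) + 2 + 1).+1) (P := off_vec) (Q := vec_inv 0)) => //;
  last by lia.
apply: (hoare_if M_ge16 (d := k == 0)) => //; first bnd.
  by move=> f /=; rewrite leqn0.
case: ifP => k0.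
  apply: (hoare_conseq (t := r * (1 + 2) + 2)
    (P := fun f => off_vec f /\ forall l, l < 0 -> f (O + r + l) = vec 0 l)
    (Q := fun f => off_vec f /\ forall l, l < r -> f (O + r + l) = vec 0 l)) => //; last by lia.
  apply: (hoare_for M_ge16 (Lx := fun l => regs R K w 0 0 0 0 0 0 l 0)
    (I := fun l' f => off_vec f /\ forall l, l < l' -> f (O + r + l) = vec 0 l)) => //;
    [bnd|by regs_eq|].
  move=> l lr; apply: (hoare_fstore M_ge16) => //; first bnd.
  move=> f [h1 h2]; rewrite /regs /= -/O; split.
    by move=> x xD; rewrite upd_neq ?h1 //; lia.
  move=> l' l'r; rewrite updE eqn_add2l; case: eqP => [->|ne]; last by apply: h2; lia.
  by rewrite h1 ?gf0 /= ?k0 //; lia.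
have r0 : 0 < r by move: wM; case: (posnP r) => // ->; rewrite exp0n //; lia.
apply: (hoare_seq (L1 := regs R K w 0 0 0 0 0 0 0 0)
  (R := fun f => off_vec f /\ forall l, l < r -> f (O + r + l) = 0%R)).
  apply: (hoare_conseq (t := r * (1 + 2) + 2)
    (P := fun f => off_vec f /\ forall l, l < 0 -> f (O + r + l) = 0%R)
    (Q := fun f => off_vec f /\ forall l, l < r -> f (O + r + l) = 0%R)) => //.
  apply: (hoare_for M_ge16 (Lx := fun l => regs R K w 0 0 0 0 0 0 l 0)
    (I := fun l' f => off_vec f /\ forall l, l < l' -> f (O + r + l) = 0%R)) => //;
    [bnd|by regs_eq|].
  move=> l lr; apply: (hoare_fstore M_ge16) => //; first bnd.
  move=> f [h1 h2]; rewrite /regs /= -/O; split.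
    by move=> x xD; rewrite upd_neq ?h1 //; lia.
  by move=> l' l'r; rewrite updE eqn_add2l; case: eqP => // ne; apply: h2; lia.
apply: (hoare_fstore M_ge16) => //; first bnd.
move=> f [h1 h2]; rewrite /regs /= -/O subn_div_mul; have wr := ltn_pmod w r0; split.
  by move=> x xD; rewrite upd_neq ?h1 //; lia.
move=> l lr; rewrite updE eqn_add2l /= k0 /digit expn0 divn1.
by case: eqP => // ne; apply: h2; lia.
Qed.

Lemma struct_addr_lt a d l : a < r -> d < r -> l < r -> (a * r + d) * r + l < O.
Proof.
move=> ar dr lr; apply: leq_trans out_addr_ge.
have h : (a * r + d).+1 * r <= r * r * r.
  by rewrite leq_mul2r; apply/orP; right; nia.
by apply: leq_trans (leq_addr _ _); apply: leq_trans h; rewrite mulSn addnC ltn_add2r.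
Qed.

Lemma next_vecP i : i < k - 1 ->
  hoare (3 * k + r * (r * 3 + 5) + 3 * r + 8) (regs R K w 0 0 0 i 0 0 0 0) (vec_inv i) next_vec
    (regs R K w 0 0 0 i 0 0 0 0) (vec_inv i.+1).
Proof.
move=> ik.
have pri : r ^ i.+1 <= M by apply: powrM; lia.
have r0 : 0 < r by move: wM; case: (posnP r) => // ->; rewrite exp0n //; lia.
pose tmp (l : nat) (f : nat -> F) := forall l', l' < l -> f (O + r + r + l') = vec i.+1 l'.
apply: (hoare_conseq (t := (3 * i.+1 + 3) + ((r * ((1 + (r * (1 + 2) + 2)) + 2) + 2) +
   ((r * (1 + 2) + 2) + 1)))
  (P := vec_inv i) (Q := vec_inv i.+1)) => //; last by lia.
apply: (hoare_seq (L1 := regs R K w 0 0 0 i 0 (r ^ i.+1) 0 0) (R := vec_inv i)).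
  apply: (hoare_pow M_ge16 (vb := r) (ve := i.+1)) => //; [bnd| |lia| |by regs_eq].
    by move=> i' hi'; apply: powrM; lia.
  by move=> p i' f /=; rewrite addn1.
apply: (hoare_seq (L1 := regs R K w 0 0 0 i 0 (r ^ i.+1) 0 0)
  (R := fun f => vec_inv i f /\ tmp r f)).
  apply: (hoare_conseq (t := r * ((1 + (r * (1 + 2) + 2)) + 2) + 2)
    (P := fun f => vec_inv i f /\ tmp 0 f) (Q := fun f => vec_inv i f /\ tmp r f)) => //.
  apply: (hoare_for M_ge16 (Lx := fun l => regs R K w 0 0 0 i 0 (r ^ i.+1) l 0)
    (I := fun l f => vec_inv i f /\ tmp l f)) => //; [bnd|by regs_eq|].
  move=> l lr.
  pose part a (f : nat -> F) := f (O + r + r + l) =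
    (\sum_(0 <= a' < a) vec i a' * f0 ((a' * r + digit r w i.+1) * r + l)%N)%R.
  apply: (hoare_seq (L1 := regs R K w 0 0 0 i 0 (r ^ i.+1) l 0)
    (R := fun f => [/\ vec_inv i f, tmp l f & part 0 f])).
    apply: (hoare_fstore M_ge16) => //; first bnd.
    move=> f [[h1 h2] h3]; rewrite /regs /= -/O; split; [split| |].
    - by move=> x xD; rewrite upd_neq ?h1 //; lia.
    - by move=> l' l'r; rewrite upd_neq ?h2 //; lia.
    - by move=> l' l'r; rewrite upd_neq ?h3 //; lia.
    - by rewrite /part upd_eq big_geq.
  apply: (hoare_conseq (t := r * (1 + 2) + 2)
    (P := fun f => [/\ vec_inv i f, tmp l f & part 0 f])
    (Q := fun f => [/\ vec_inv i f, tmp l f & part r f])) => //; last first.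
    move=> f [h1 h2 h3]; split=> // l' l'l; have [/h2//|ll'] := ltnP l' l.
    by have -> : l' = l by lia.
  apply: (hoare_for M_ge16 (Lx := fun a => regs R K w 0 0 0 i 0 (r ^ i.+1) l a)
    (I := fun a f => [/\ vec_inv i f, tmp l f & part a f])) => //; [bnd|by regs_eq|].
  move=> a ar; apply: (hoare_fstore M_ge16) => //; first bnd.
  move=> f [[h1 h2] h3 h4]; rewrite /regs /= -/O subn_div_mul; split; [split| |].
  - by move=> x xD; rewrite upd_neq ?h1 //; lia.
  - by move=> l' l'r; rewrite upd_neq ?h2 //; lia.
  - by move=> l' l'r; rewrite upd_neq ?h3 //; lia.
  - have h := struct_addr_lt ar (ltn_pmod (w %/ r ^ i.+1) r0) lr.
    rewrite /part upd_eq h4 big_nat_recr //= h2 //; congr (_ + _ * _)%R.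
    by rewrite h1 ?gf0 //; lia.
apply: (hoare_seq (L1 := regs R K w 0 0 0 i 0 (r ^ i.+1) 0 0) (R := vec_inv i.+1)); last first.
  by apply: (hoare_istore M_ge16 (v := 0)) => //; [bnd | regs_eq].
apply: (hoare_conseq (t := r * (1 + 2) + 2)
  (P := fun f => [/\ off_vec f, tmp r f & forall l, l < 0 -> f (O + r + l) = vec i.+1 l])
  (Q := fun f => [/\ off_vec f, tmp r f & forall l, l < r -> f (O + r + l) = vec i.+1 l])) => //.
- apply: (hoare_for M_ge16 (Lx := fun l => regs R K w 0 0 0 i 0 (r ^ i.+1) l 0)
    (I := fun l' f => [/\ off_vec f, tmp r f & forall l, l < l' -> f (O + r + l) = vec i.+1 l])) => //;
    [bnd|by regs_eq|].
  move=> l lr; apply: (hoare_fstore M_ge16) => //; first bnd.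
  move=> f [h1 h2 h3]; rewrite /regs /= -/O; split.
  + by move=> x xD; rewrite upd_neq ?h1 //; lia.
  + by move=> l' l'r; rewrite upd_neq ?h2 //; lia.
  + move=> l' l'r; rewrite updE eqn_add2l; case: eqP => [->|ne]; first by rewrite h2.
    by apply: h3; lia.
- by move=> f [[h1 h2] h3].
- by move=> f [h1 h2 h3].
Qed.

Definition vec_time := r * 3 + 4 + ((k - 1) * (3 * k + r * (r * 3 + 5) + 3 * r + 8 + 2) + 2).

Lemma vec_cmdP :
  hoare vec_time (regs R K w 0 0 0 0 0 0 0 0) off_vec vec_cmd
    (regs R K w 0 0 0 0 0 0 0 0) (vec_inv k.-1).
Proof.
(* The first letter is already loaded, so k - 1 factors remain; truncated subtraction gives no round
   for k = 0. *)
apply: (hoare_seq first_vecP); rewrite -subn1.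
apply: (hoare_for M_ge16 (Lx := fun i => regs R K w 0 0 0 i 0 0 0 0)
    (I := vec_inv)) => //; [bnd|lia|by regs_eq|exact: next_vecP].
Qed.

End Vec.

Definition word_inv (w : nat) (f : nat -> F) : Prop :=
  (forall x, x < O -> f x = f0 x) /\
  forall l, l < r -> f (O + l) = word_sum q n k r f0 w l.

Definition word_time := dp_time + (vec_time + (r * 3 + 2)).

Lemma word_cmdP :
  hoare word_time (regs R K w 0 0 0 0 0 0 0 0) (word_inv w) (word_cmd q)
    (regs R K w 0 0 0 0 0 0 0 0) (word_inv w.+1).
Proof.
have K0 : 0 < K by rewrite expn_gt0.
pose dpv := dp n K.-1.
apply: (hoare_seq (L1 := regs R K w 0 0 0 0 0 0 0 0)
  (R := fun f => word_inv w f /\ f (O + r + r + r + K) = dpv)).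
  apply: hoare_ghost => g [gf0 gout].
  apply: (hoare_conseq (dp_cmdP gf0)) => //; first by move=> f <-.
  move=> f [h1 h2]; split=> //; split.
    by move=> x xO; rewrite h1 ?gf0 //; lia.
  by move=> l lr; rewrite h1 ?gout //; lia.
apply: (hoare_seq (L1 := regs R K w 0 0 0 0 0 0 0 0)
  (R := fun f => [/\ word_inv w f, f (O + r + r + r + K) = dpv &
     forall l, l < r -> f (O + r + l) = word_vec k r f0 w k.-1 l])).
  apply: hoare_ghost => g [[gf0 gout] gdp].
  apply: (hoare_conseq (vec_cmdP gf0)) => //; first by move=> f <-.
  move=> f [h1 h2]; split=> //; first split.
  - by move=> x xO; rewrite h1 ?gf0 //; lia.
  - by move=> l lr; rewrite h1 ?gout //; lia.
  - by rewrite h1 //; lia.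
(* Coordinates are updated one at a time: those below c already include the word w. *)
pose inv c (f : nat -> F) := [/\ forall x, x < O -> f x = f0 x,
   forall l, l < r -> f (O + l) = word_sum q n k r f0 (if l < c then w.+1 else w) l,
   f (O + r + r + r + K) = dpv &
   forall l, l < r -> f (O + r + l) = word_vec k r f0 w k.-1 l].
apply: (hoare_conseq (t := r * (1 + 2) + 2) (P := inv 0) (Q := inv r)) => //.
- apply: (hoare_for M_ge16 (Lx := fun l => regs R K w 0 0 0 0 0 0 l 0)
    (I := inv)) => //; [bnd|by regs_eq|].
  move=> l lr; apply: (hoare_fstore M_ge16) => //; first bnd.
  move=> f [h1 h2 h3 h4]; rewrite /regs /= -/O; split.
  + by move=> x xD; rewrite upd_neq ?h1 //; lia.
  + move=> l' l'r; rewrite updE eqn_add2l; case: eqP => [->|ne]; last first.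
      by rewrite h2 //; have -> : (l' < l.+1) = (l' < l) by lia.
    rewrite ltnS leqnn h2 // ltnn h4 // /word_sum big_nat_recr //=; congr (_ + _ * _)%R.
    by rewrite -/dpv -h3; congr (f _); lia.
  + by rewrite upd_neq ?h3 //; lia.
  + by move=> l' l'r; rewrite upd_neq ?h4 //; lia.
- by move=> f [[h1 h2] h3 h4]; split.
- by move=> f [h1 h2 h3 h4]; split=> // l lr; rewrite h2 // lr.
Qed.

End Word.

Definition main_time :=
  3 * k + 3 + (3 * k + 3 + (R * (word_time + 2) + 2 + (r * 3 + 2))).

Lemma main_cmdP :
  (forall l, l < r -> f0 (O + l) = 0%R) ->
  hoare main_time (nth 0 [:: n; k; r]) (eq f0) (main_cmd q)
    (regs R K 0 0 0 0 0 0 0 0 0)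
    (fun f => forall l, l < r -> f l = word_sum q n k r f0 R l).
Proof.
move=> f00.
have RM : R <= M by exact: powrM.
have KM : K <= M by exact: pow2M.
(* The final copy into cells 0 to r-1 must not touch the accumulators it reads. *)
have rO : r <= O by rewrite /out_addr; lia.
have -> : nth 0 [:: n; k; r] = regs 0 0 0 0 0 0 0 0 0 0 0.
  apply: functional_extensionality => x; rewrite /regs.
  by do 3?[case: x => //= x]; rewrite nth_nil; do 11?[case: x => //= x]; rewrite nth_nil.
apply: (hoare_seq (L1 := regs R 0 0 0 0 0 0 0 0 0 0) (R := eq f0)).
  apply: (hoare_pow M_ge16 (vb := r) (ve := k)) => //; [bnd|lia|by regs_eq].
apply: (hoare_seq (L1 := regs R K 0 0 0 0 0 0 0 0 0) (R := eq f0)).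
  apply: (hoare_pow M_ge16 (vb := 2) (ve := k)) => //; [bnd|lia|by regs_eq].
apply: (hoare_seq (L1 := regs R K 0 0 0 0 0 0 0 0 0) (R := word_inv R)).
  apply: (hoare_conseq (t := R * (word_time + 2) + 2) (P := word_inv 0) (Q := word_inv R)) => //;
    last first.
    by move=> f <-; split=> // l lr; rewrite f00 // /word_sum big_geq.
  apply: (hoare_for M_ge16 (Lx := fun w => regs R K w 0 0 0 0 0 0 0 0)
    (I := word_inv)) => //; [bnd|by regs_eq|exact: word_cmdP].
pose inv c (f : nat -> F) := (forall l, l < r -> f (O + l) = word_sum q n k r f0 R l) /\
   (forall l, l < c -> f l = word_sum q n k r f0 R l).
apply: (hoare_conseq (t := r * (1 + 2) + 2) (P := inv 0) (Q := inv r)) => //.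
- apply: (hoare_for M_ge16 (Lx := fun l => regs R K 0 0 0 0 0 0 0 l 0)
    (I := inv)) => //; [bnd|by regs_eq|].
  move=> l lr; apply: (hoare_fstore M_ge16) => //; first bnd.
  move=> f [h1 h2]; rewrite /regs /= -/O; split.
  + by move=> l' l'r; rewrite upd_neq ?h1 //; lia.
  + move=> l' l'l; rewrite updE; case: eqP => [->|ne]; first by rewrite h1.
    by apply: h2; lia.
- by move=> f [h1 h2]; split.
- by move=> f [h1 h2].
Qed.

End Correct.

(** * Scalar permanents and determinants *)

Lemma bit_bits (b : nat -> bool) k i :
  bit (\sum_(0 <= x < k) b x * 2 ^ x) i = (i < k) && b i.
Proof.
elim: k b i => [|k IH] b i; first by rewrite big_geq // /bit div0n.
rewrite big_nat_recl //= muln1.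
have -> : \sum_(0 <= x < k) b x.+1 * 2 ^ x.+1 = 2 * \sum_(0 <= x < k) b x.+1 * 2 ^ x.
  by rewrite big_distrr /=; apply: eq_bigr => x _; rewrite expnS mulnCA.
set m := (\sum_(0 <= x < k) _).
case: i => [|i]; first by rewrite /bit expn0 divn1 oddD mul2n odd_double addbF oddb.
rewrite /bit expnS divnMA addnC mulnC divnMDl // [b 0 %/ 2]divn_small ?addn0; last by case: (b 0).
exact: (IH (fun x => b x.+1)).
Qed.

(** * Sets of rows as bit masks *)

Section Mask.
Variable k : nat.
Implicit Type S : {set 'I_k}.

Definition mask S : nat := \sum_(i in S) 2 ^ i.

Lemma maskE S : mask S = \sum_(0 <= x < k) (x \in [seq val i | i in S]) * 2 ^ x.
Proof.
rewrite big_mkord /mask big_mkcond; apply: eq_bigr => i _.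
by rewrite mem_map ?mem_enum; [case: ifP; rewrite (mul1n, mul0n) | apply: val_inj].
Qed.

Lemma bit_mask S (i : 'I_k) : bit (mask S) i = (i \in S).
Proof. by rewrite maskE bit_bits ltn_ord mem_map ?mem_enum //; apply: val_inj. Qed.

Lemma mask_setD1 S (i : 'I_k) : i \in S -> mask (S :\ i) = mask S - 2 ^ i.
Proof. by move=> iS; rewrite /mask [in RHS](big_setD1 i) //= addKn. Qed.

Lemma mask_eq0 S : (mask S == 0) = (S == set0).
Proof.
rewrite sum_nat_eq0; apply/forall_inP/eqP => [h|->]; last by move=> i; rewrite inE.
by apply/setP => i; rewrite inE; apply/negP => /h; rewrite expn_eq0.
Qed.

Lemma mask_setT : mask [set: 'I_k] = (2 ^ k).-1.
Proof. by rewrite predn_exp mul1n /mask; apply: eq_bigl => i; rewrite inE. Qed.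

End Mask.

Definition inversions (k n : nat) (f : 'I_k -> 'I_n) : nat :=
  \sum_(i < k) \sum_(i' < k | i' < i) (f i < f i').

(** * Partial injections and the recurrence of the table *)

Section Injections.
Variables (F : fieldType) (q : bool) (n k : nat) (a : nat -> nat -> F).
Local Notation sg := ((-1) ^+ q : F)%R.
Local Notation pfun := {ffun 'I_k -> option 'I_n}.
Implicit Types (f : pfun) (S : {set 'I_k}).

(** An injection of S into the last j columns. Values in [option] put all S and j in one finite
    type, where [pset] adds or removes a row. *)
Definition pinj (j : nat) S f : bool :=
  [forall i, if f i is Some c then (i \in S) && (n - j <= c) else i \notin S] &&
  [forall i, forall i', (i != i') ==> (f i != None) ==> (f i != f i')].

Lemma pinjP j S f : reflect
  [/\ forall i, (i \in S) = (f i != None), forall i c, f i = Some c -> n - j <= c &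
      forall i i', f i != None -> f i = f i' -> i = i'] (pinj j S f).
Proof.
apply: (iffP andP) => [[/forallP h1 /forallP h2]|[h1 h2 h3]].
  split.
  - by move=> i; move: (h1 i); case: (f i) => [c /andP[-> _]|/negPf ->].
  - by move=> i c fi; move: (h1 i); rewrite fi => /andP[].
  - move=> i i' ni e; apply/eqP; apply/idP; apply: contraT => nii'.
    by move: (h2 i) => /forallP /(_ i'); rewrite nii' ni e eqxx.
split; apply/forallP => i.
  move: (h1 i) (h2 i); case: (f i) => [c ->|->] // /(_ c) ->//.
apply/forallP => i'; apply/implyP => nii'; apply/implyP => ni.
by apply/negP => /eqP /(h3 _ _ ni) /eqP; rewrite (negPf nii').
Qed.

Definition oinv (x y : option 'I_n) : bool :=
  if x is Some c' then (if y is Some c then c < c' else false) else false.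

Definition pweight f : F :=
  (sg ^+ (\sum_(i < k) \sum_(i' < k | i' < i) oinv (f i') (f i))
   * \prod_i (if f i is Some c then a i c else 1))%R.

Definition pset f (i : 'I_k) (o : option 'I_n) : pfun :=
  [ffun x => if x == i then o else f x].

Lemma pweight_pset j S f i (c : 'I_n) :
  (n - j = c.+1)%N -> i \in S -> pinj j (S :\ i) f ->
  pweight (pset f i (Some c)) =
  (sg ^+ (\sum_(0 <= i' < i) bit (mask S) i') * (a i c * pweight f))%R.
Proof.
move=> nc iS /pinjP[h1 h2 h3].
have fi : f i = None by apply/eqP; move: (h1 i); rewrite !inE eqxx /=; case: eqP.
rewrite /pweight [X in (_ * X = _)%R](bigD1 i) //= ffunE eqxx.
rewrite [X in (_ = _ * (_ * (_ * X)))%R](bigD1 i) //= fi mul1r.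
have -> : (\prod_(i0 | i0 != i) (if pset f i (Some c) i0 is Some c0 then a i0 c0 else 1) =
  \prod_(i0 | i0 != i) (if f i0 is Some c0 then a i0 c0 else 1))%R.
  by apply: eq_bigr => x /negPf nx; rewrite ffunE nx.
set P := (\prod_(_ | _) _)%R.
have -> : \sum_(x < k) \sum_(i' < k | i' < x) oinv (pset f i (Some c) i') (pset f i (Some c) x) =
  \sum_(0 <= i' < i) bit (mask S) i' + \sum_(x < k) \sum_(i' < k | i' < x) oinv (f i') (f x).
  rewrite big_mkord (big_ord_widen k (fun i' => bit (mask S) i' : nat)); last exact: ltnW.
  (* Only pairs containing row i change. With i as the later row, each earlier row of S is inverted
     with c; with i as the earlier row there is no inversion, since c lies below all columns in
     use. *)
  have inv1 (x x' : 'I_k) : x' < x ->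
      (oinv (pset f i (Some c) x') (pset f i (Some c) x) : nat) =
      (if x == i then (x' \in S : nat) else 0) + oinv (f x') (f x).
    move=> x'x; rewrite !ffunE; case: (x =P i) => [xi|nxi].
      have nx'i : x' != i by rewrite -xi neq_ltn x'x.
      rewrite (negPf nx'i) xi fi; have := h1 x'; rewrite !inE nx'i /= => ->.
      by case e: (f x') => [c'|] //=; have := h2 _ _ e; rewrite nc => ->.
    case: (x' =P i) => [->|//]; rewrite fi /=; case e: (f x) => [c'|] //.
    by have := h2 _ _ e; rewrite nc /= => h; have -> : (c' < c) = false by lia.
  under eq_bigr => x _ do under eq_bigr => x' x'x do rewrite (inv1 _ _ x'x).
  under eq_bigr => x _ do rewrite big_split.
  rewrite big_split /=; congr (_ + _); rewrite (bigD1 i) //= [X in _ + X]big1 ?addn0.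
    by apply: eq_bigr => x' _; rewrite eqxx bit_mask.
  by move=> x /negPf nx; apply: big1 => x' _; rewrite nx.
by rewrite exprD; ring.
Qed.

(** Injections into the last j+1 columns are split by whether they use the new column c, and if so
    by the row matched to c. *)
Lemma dp_pinj j S : j <= n ->
  dp q n k a j (mask S) = (\sum_(f | pinj j S f) pweight f)%R.
Proof.
elim: j S => [|j IH] S jn /=.
  rewrite mask_eq0; case: (S =P set0) => [->|/eqP nS].
    rewrite (big_pred1 [ffun=> None]) => [|f].
      rewrite /pweight big1 ?expr0 ?mul1r => [|i _]; last first.
        by apply: big1 => i' _; rewrite !ffunE.
      by rewrite big1 // => i _; rewrite ffunE.
    apply/pinjP/eqP => [[h1 _ _]|->].
      by apply/ffunP => i; have := h1 i; rewrite !inE ffunE; case: (f i).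
    by split=> [i|i c|i i']; rewrite !ffunE ?inE.
  rewrite big_pred0 // => f; apply/negP => /pinjP[h1 h2 _].
  case/set0Pn: nS => i; rewrite h1; case e: (f i) => [c|//].
  by have := h2 _ _ e; rewrite subn0 leqNgt ltn_ord.
have cn : n - j.+1 < n by lia.
pose c := Ordinal cn; have nc : n - j = c.+1 by rewrite /=; lia.
rewrite [RHS](bigID (fun f => [forall i, f i != Some c])) /=; congr (_ + _)%R.
  rewrite IH ?(ltnW jn) //; apply: eq_bigl => f.
  apply/pinjP/andP => [[h1 h2 h3]|[/pinjP[h1 h2 h3] /forallP h4]].
    split; first by apply/pinjP; split=> // i c' e; have := h2 _ _ e; lia.
    by apply/forallP => i; apply/eqP => /h2; rewrite nc ltnn.
  split=> // i c' e; have := h2 _ _ e; rewrite leq_eqVlt => /orP[/eqP cc'|]; last by lia.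
  by have := h4 i; rewrite e => /eqP[]; congr Some; apply: val_inj.
(* By injectivity at most one row is matched to c, so the inner sum has exactly one term when c is
   used and none otherwise. *)
have -> : (\sum_(f | pinj j.+1 S f && ~~ [forall i, f i != Some c]) pweight f =
  \sum_(f | pinj j.+1 S f) \sum_(i | f i == Some c) pweight f)%R.
  rewrite [RHS](bigID (fun f => [forall i, f i != Some c])) /= [X in (_ = X + _)%R]big1 ?add0r.
    apply: eq_bigr => f /andP[/pinjP[h1 h2 h3] /forallPn[i /negbNE /eqP fi]].
    rewrite (big_pred1 i) // => i' /=; apply/eqP/eqP => [e|->//].
    by apply: h3; rewrite e // fi.
  by move=> f /andP[_ /forallP h]; apply: big1 => i; rewrite (negPf (h i)).
rewrite (exchange_big_dep (mem S)) /=; last first.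
  by move=> f i /pinjP[h1 _ _] /eqP e; rewrite h1 e.
rewrite big_mkord big_mkcond [RHS]big_mkcond; apply: eq_bigr => i _ /=; rewrite bit_mask.
case: ifP => // iS.
(* Adding and removing the pair (i, c) are inverse bijections between the injections of S minus i
   into the last j columns and those of S that send i to c. *)
rewrite (reindex_onto (fun f => pset f i (Some c)) (fun f => pset f i None)) /=; last first.
  move=> f /andP[_ /eqP fi]; apply/ffunP => x; rewrite !ffunE.
  by case: eqP => // ->.
rewrite /dp_term -mask_setD1 // IH ?(ltnW jn) // !big_distrr /=.
apply: eq_big => [f|f pf]; last by rewrite (pweight_pset nc iS pf).
apply/pinjP/andP => [[h1 h2 h3]|[/andP[/pinjP[h1 h2 h3] _] /eqP e]].
  have fi : f i = None by apply/eqP; move: (h1 i); rewrite !inE eqxx /=; case: eqP.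
  have fc x : f x != Some c by apply/eqP => /h2; rewrite nc ltnn.
  split; last first.
    by apply/eqP/ffunP => x; rewrite !ffunE; case: eqP => // ->.
  rewrite ffunE !eqxx andbT; apply/pinjP; split.
  - move=> x; have := h1 x; rewrite ffunE !inE; by case: (x =P i) => [->|_ /= ->]; rewrite ?iS.
  - move=> x c'; rewrite ffunE; case: eqP => [_ [<-]|_ /h2]; rewrite ?leqnn //; lia.
  - move=> x x'; rewrite !ffunE; case: (x =P i) => [->|nxi]; case: (x' =P i) => [->|nx'i] //.
    + by move=> _ /esym /eqP; rewrite (negPf (fc _)).
    + by move=> _ /eqP; rewrite (negPf (fc _)).
    + exact: h3.
have fi : f i = None by rewrite -e !ffunE eqxx.
have hE x : x != i -> pset f i (Some c) x = f x by rewrite ffunE => /negPf ->.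
split.
- move=> x; rewrite !inE; case: (x =P i) => [->|/eqP nx] /=; first by rewrite fi.
  by rewrite h1 hE.
- move=> x c' fx; have nx : x != i by apply/eqP => xi; rewrite xi fi in fx.
  have := h2 x c'; rewrite hE // => /(_ fx); rewrite leq_eqVlt => /orP[/eqP cc'|]; last by lia.
  have : x = i; last by move/eqP; rewrite (negPf nx).
  apply: h3; rewrite hE // fx // ffunE eqxx; congr Some; exact: val_inj.
- move=> x x' nx fxx'; have nxi : x != i by apply: contraNneq nx => ->; rewrite fi.
  have nx'i : x' != i by apply: contraNneq nx => xi; rewrite fxx' xi fi.
  by apply: h3; rewrite !hE.
Qed.

(** A partial injection whose domain is the full row set is total; [pick] provides the partial
    inverse of the embedding [some_fun]. *)
Lemma dp_injections :
  dp q n k a n (2 ^ k).-1 =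
  (\sum_(f : {ffun 'I_k -> 'I_n} | injectiveb f)
     sg ^+ inversions f * \prod_(i < k) a i (f i))%R.
Proof.
rewrite -mask_setT dp_pinj //.
pose some_fun (f : {ffun 'I_k -> 'I_n}) : pfun := [ffun i => Some (f i)].
have some_inj : injective some_fun.
  by move=> f g /ffunP e; apply/ffunP => i; have := e i; rewrite !ffunE => -[].
rewrite (reindex_omap some_fun (fun g => [pick f | some_fun f == g])); last first.
  move=> g /pinjP[h1 _ _]; case: pickP => [f /eqP <- //|h].
  have /fin_all_exists[f hf] : forall i, exists c, g i = Some c.
    by move=> i; have := h1 i; rewrite inE; case: (g i) => // c _; exists c.
  by have /eqP[] := h (finfun f); apply/ffunP => i; rewrite !ffunE hf.
apply: eq_big => [f|f _].
  have -> : [pick f0 | some_fun f0 == some_fun f] == Some f.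
    by case: pickP => [f' /eqP/some_inj -> //|/(_ f)]; rewrite eqxx.
  rewrite andbT; apply/pinjP/injectiveP => [[_ _ h] x y e|h].
    by apply: h; rewrite !ffunE // e.
  split=> [i|i c|i i']; rewrite !ffunE ?inE ?subnn //.
  by move=> _ [] /h.
rewrite /pweight; congr (_ ^+ _ * _)%R; last by apply: eq_bigr => i _; rewrite ffunE.
by apply: eq_bigr => i _; apply: eq_bigr => i' _; rewrite !ffunE.
Qed.

End Injections.

(* The Vandermonde determinant of the permuted nodes 0, ..., k-1 is the product of
   the s j - s i over i < j; its sign is read off the inversions. *)
Lemma odd_inversions k (s : 'S_k) : odd (inversions s) = s.
Proof.
pose x (t : 'S_k) : 'rV[int]_k := (\row_j (t j)%:Z)%R.
have detE : (\det (Vandermonde k (x s)) = \det (Vandermonde k (x 1%g)) * (-1) ^+ s)%R.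
  have -> : (Vandermonde k (x s) = col_perm s (Vandermonde k (x 1%g)))%R.
    by apply/matrixP => i j; rewrite !mxE perm1.
  by rewrite col_permE det_mulmx det_perm odd_permV.
have sgE (t : 'S_k) : (Num.sg (\det (Vandermonde k (x t))) = (-1) ^+ inversions t)%R.
  rewrite det_Vandermonde /inversions (exchange_big_dep predT) //=.
  rewrite (big_morph _ (@sgrM _) (@sgr1 _)) -prodrXr.
  apply: eq_bigr => i _; rewrite (big_morph _ (@sgrM _) (@sgr1 _)) -prodrXr.
  apply: eq_bigr => j ij; rewrite !mxE -neqr0_sign ?subr_lt0 //.
  by rewrite subr_eq0; apply: contraTneq ij => -[/val_inj/perm_inj ->]; rewrite ltnn.
have := congr1 Num.sg detE; rewrite sgrM sgE sgE sgrX sgrN1.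
have -> : inversions (1%g : 'S_k) = 0.
  by apply: big1 => i _; apply: big1 => j ji; rewrite !perm1 ltnNge (ltnW ji).
rewrite mul1r -signr_odd; case: (odd _) (odd_perm s) => [] [] //.
Qed.

Lemma enum_val_ltn n (S : {set 'I_n}) (x y : 'I_#|S|) :
  (enum_val x < enum_val y) = (x < y).
Proof.
have srt : sorted (fun i j : 'I_n => i < j) (enum S).
  rewrite /enum_mem; apply: sorted_filter; first by move=> ? ? ?; apply: ltn_trans.
  rewrite -enumT; have := sorted_map (f := val) (e' := ltn) (enum 'I_n).
  by rewrite val_enum_ord iota_ltn_sorted => /esym.
have szE : size (enum S) = #|S| by rewrite cardE.
have mono (u v : 'I_#|S|) : u < v -> enum_val u < enum_val v.
  move=> uv; rewrite (enum_val_nth (enum_val u)) [enum_val v](enum_val_nth (enum_val u)).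
  apply: (sorted_ltn_nth (leT := fun i j : 'I_n => i < j) _ _ srt) => //;
    rewrite ?inE ?szE //.
  by move=> ? ? ?; apply: ltn_trans.
case: (ltngtP x y) => [/mono ->//|/mono h|/val_inj ->]; last by rewrite ltnn.
by rewrite ltnNge (ltnW h).
Qed.

(** * Both functions as signed sums over injections *)

Section Determinant.
Variables (F : fieldType) (V : vectType F) (mul : V -> V -> V) (u : V) (k n : nat).
Variable (A : 'M[V]_(k, n)).

Definition signed_sum (q : bool) : V :=
  (\sum_(f : {ffun 'I_k -> 'I_n} | injectiveb f)
     ((-1) ^+ q) ^+ inversions f *: oprod mul u [seq A i (f i) | i <- enum 'I_k])%R.

Lemma rper_signed_sum : rper mul u A = signed_sum false.
Proof. by apply: eq_bigr => f _; rewrite expr0 expr1n scale1r. Qed.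

(** Injections are grouped by their image S. Those with image S are the permutations followed by the
    increasing enumeration of S, which preserves inversions. *)
Lemma rdet_signed_sum : rdet mul u A = signed_sum true.
Proof.
rewrite /signed_sum (partition_big (fun f : {ffun 'I_k -> 'I_n} => f @: [set: 'I_k])
  (fun S => #|S| == k)) /=; last first.
  by move=> f /injectiveP fi; rewrite card_imset // cardsT card_ord.
apply: eq_bigr => S /eqP Sk.
pose h (s : 'S_k) : {ffun 'I_k -> 'I_n} :=
  [ffun i => enum_val (cast_ord (esym Sk) (s i))].
have h_inj : injective h.
  move=> s t /ffunP e; apply/permP => i; have := e i; rewrite !ffunE.
  by move=> /enum_val_inj /cast_ord_inj.
have h_fun (s : 'S_k) : injective (h s).
  by move=> x y; rewrite !ffunE => /enum_val_inj /cast_ord_inj /perm_inj.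
rewrite [RHS](reindex_omap h (fun f => [pick s | h s == f])); last first.
  move=> f /andP[/injectiveP fi /eqP fS]; case: pickP => [s /eqP <- //|no].
  have /fin_all_exists[t ht] : forall i, exists o : 'I_k, enum_val (cast_ord (esym Sk) o) = f i.
    move=> i; have fiS : f i \in S by rewrite -fS imset_f.
    by exists (cast_ord Sk (enum_rank_in fiS (f i))); rewrite cast_ordK enum_rankK_in.
  have ti : injective t by move=> x y e; apply: fi; rewrite -!ht e.
  by have /eqP[] := no (perm ti); apply/ffunP => i; rewrite ffunE permE ht.
apply: eq_big => [s|s _].
  have -> : [pick s0 | h s0 == h s] == Some s.
    by case: pickP => [s' /eqP/h_inj -> //|/(_ s)]; rewrite eqxx.
  rewrite andbT; apply/esym/andP; split; first exact/injectiveP/h_fun.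
  rewrite eqEcard card_imset // cardsT card_ord Sk leqnn andbT.
  by apply/subsetP => x /imsetP[i _ ->]; rewrite ffunE enum_valP.
have -> : inversions (h s) = inversions s.
  by apply: eq_bigr => i _; apply: eq_bigr => i' _; rewrite !ffunE enum_val_ltn.
rewrite expr1 -[in RHS]signr_odd odd_inversions; congr (_ *: oprod mul u _)%R.
apply: eq_map => i; rewrite ffunE (enum_val_nth (enum_val (cast_ord (esym Sk) (s i)))) /=.
by rewrite (nth_map (enum_val (cast_ord (esym Sk) (s i)))) // -cardE Sk.
Qed.

End Determinant.

(** * Expansion over words *)

Lemma linear_fun_sum (F : fieldType) (V : vectType F) (f : V -> V) (I : Type)
    (s : seq I) (c : I -> F) (v : I -> V) :
  linear f -> f (\sum_(i <- s) c i *: v i)%R = (\sum_(i <- s) c i *: f (v i))%R.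
Proof.
move=> lf; elim: s => [|i s IH]; last by rewrite !big_cons lf IH.
(* Linearity at -1, 0, 0 reads f 0 = - f 0 + f 0, hence f 0 = 0. *)
by rewrite !big_nil; have := lf (-1)%R 0%R 0%R; rewrite scaler0 addr0 scaleN1r addNr.
Qed.

Lemma iota_rcons m : iota 0 m.+1 = rcons (iota 0 m) m.
Proof. by rewrite -addn1 iotaD cats1. Qed.

(** Appending the letter d to a word w of length k gives the code d * r^k + w; the earlier letters
    are unaffected. *)
Lemma digit_low r k w d i : i < k -> digit r (d * r ^ k + w) i = digit r w i.
Proof.
move=> ik; rewrite /digit; have [->|r0] := posnP r; first by rewrite !modn0 exp0n ?muln0 //; lia.
have -> : d * r ^ k = (d * r ^ (k - i.+1) * r) * r ^ i.
  by rewrite -!mulnA -expnS -expnD; congr (_ * _ ^ _); lia.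
by rewrite divnMDl ?expn_gt0 ?r0 // modnMDl.
Qed.

Lemma digit_high r k w d : d < r -> w < r ^ k -> digit r (d * r ^ k + w) k = d.
Proof.
move=> dr wk; have r0 : 0 < r by lia.
by rewrite /digit divnMDl ?expn_gt0 ?r0 // divn_small // addn0 modn_small.
Qed.

Lemma sum_words (V : zmodType) r k (G : nat -> V) :
  (\sum_(0 <= w < r ^ k.+1) G w =
   \sum_(0 <= w < r ^ k) \sum_(0 <= d < r) G (d * r ^ k + w)%N)%R.
Proof.
rewrite expnS big_nat_mul exchange_big /=; apply: eq_bigr => d _.
by rewrite mulSn -{1}[d * _]add0n big_addn addnK; apply: eq_bigr => w _; rewrite addnC.
Qed.

Section Algebra.
Variables (F : fieldType) (V : vectType F) (mul : V -> V -> V) (u : V).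
Hypothesis alg : is_algebra mul.

Lemma oprod_rcons s x : s != [::] -> oprod mul u (rcons s x) = mul (oprod mul u s) x.
Proof. by case: s => //= y s _; rewrite -cats1 foldl_cat. Qed.

(** Induction on the last factor, because [oprod] associates to the left. *)
Lemma oprod_expand r (E : nat -> V) k (X : 'I_k -> V) (C : 'I_k -> nat -> F) :
  (forall i, X i = \sum_(0 <= l < r) C i l *: E l)%R ->
  oprod mul u [seq X i | i <- enum 'I_k] =
  (\sum_(0 <= w < r ^ k) (\prod_(i < k) C i (digit r w i)) *:
     oprod mul u [seq E (digit r w i) | i <- iota 0 k])%R.
Proof.
elim: k X C => [|k IH] X C XE.
  rewrite expn0 big_nat1 big_ord0 scale1r.
  by have -> : enum 'I_0 = [::] by apply: size0nil; rewrite size_enum_ord.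
(* One factor is treated apart: [oprod] of a singleton is that factor, not its product with [u]. *)
have [k0|k_gt0] := posnP k.
  subst k; rewrite expn1 enum_ordSr.
  have -> : enum 'I_0 = [::] by apply: size0nil; rewrite size_enum_ord.
  rewrite /= XE; apply: eq_big_nat => l lr.
  by rewrite big_ord_recr big_ord0 /= mul1r /digit expn0 divn1 modn_small.
rewrite enum_ordSr map_rcons oprod_rcons -?size_eq0 ?size_map -?enumT ?size_enum_ord -?lt0n //.
rewrite -map_comp (IH _ (fun i => C (widen_ord (leqnSn k) i))) => [|i]; last exact: XE.
rewrite XE sum_words (linear_fun_sum _ _ _ (algebra_linearl alg _)).
apply: eq_big_nat => w wr.
rewrite (linear_fun_sum _ _ _ (algebra_linearr alg _)) scaler_sumr.
apply: eq_big_nat => d dr.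
rewrite scalerA iota_rcons map_rcons oprod_rcons -?size_eq0 ?size_map ?size_iota -?lt0n //.
rewrite digit_high //; congr (_ *: mul (oprod mul u _) _)%R.
  rewrite big_ord_recr /= digit_high //; congr (_ * _)%R.
  by apply: eq_bigr => i _; rewrite digit_low.
by apply/eq_in_map => i; rewrite mem_iota => /andP[_ ik]; rewrite digit_low.
Qed.

End Algebra.

Lemma nth_flatten_blocks (T : Type) (x0 : T) (ss : seq (seq T)) m i l :
  (forall s, s \in [seq size s | s <- ss] -> s = m) -> i < size ss -> l < m ->
  nth x0 (flatten ss) (i * m + l) = nth x0 (nth [::] ss i) l.
Proof.
elim: ss i => [|s ss IH] // i sz; rewrite /= ltnS => iss lm.
have sm : size s = m by apply: sz; rewrite inE eqxx.
rewrite nth_cat sm; case: i iss => [|i] iss; first by rewrite add0n lm.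
rewrite mulSn -addnA ltnNge leq_addr /= addKn IH // => s' s'ss.
by apply: sz; rewrite inE s'ss orbT.
Qed.

(** * Layout of the input and meaning of the computed values *)

Section Input.
Variables (F : fieldType) (r : nat) (V : vectType F) (mul : V -> V -> V) (e : r.-tuple V).
Variables (u : V) (k n : nat) (A : 'M[V]_(k, n)).

Lemma size_coords v : size (coords e v) = r.
Proof. by rewrite size_map size_enum_ord. Qed.

Lemma nth_coords v (l : 'I_r) : nth 0%R (coords e v) l = coord e l v.
Proof. by rewrite (nth_map l) ?size_enum_ord // nth_ord_enum. Qed.

Definition coord_table p q (x : 'I_p -> 'I_q -> V) : seq F :=
  flatten [seq coords e (x a b) | a <- enum 'I_p, b <- enum 'I_q].

Lemma shape_coord_table p q (x : 'I_p -> 'I_q -> V) s :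
  s \in shape [seq coords e (x a b) | a <- enum 'I_p, b <- enum 'I_q] -> s = r.
Proof. by case/mapP => c /allpairsP[ab [_ _ ->]] ->; rewrite size_coords. Qed.

Lemma size_coord_table p q (x : 'I_p -> 'I_q -> V) : size (coord_table x) = p * q * r.
Proof.
rewrite /coord_table size_flatten; set ss := [seq _ | a <- _, b <- _].
have /all_pred1P -> : all (pred1 r) (shape ss).
  by apply/allP => s /shape_coord_table ->; rewrite /= eqxx.
by rewrite sumn_nseq size_map size_allpairs !size_enum_ord mulnC.
Qed.

Lemma nth_coord_table p q (x : 'I_p -> 'I_q -> V) (a : 'I_p) (b : 'I_q) (l : 'I_r) :
  nth 0%R (coord_table x) ((a * q + b) * r + l) = coord e l (x a b).
Proof.
rewrite /coord_table nth_flatten_blocks //; last 2 first.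
- exact: shape_coord_table.
- rewrite size_allpairs !size_enum_ord; apply: (@leq_trans (a.+1 * q)).
    by rewrite mulSn addnC ltn_add2r.
  by rewrite leq_mul2r ltn_ord orbT.
(* The list of blocks is itself a concatenation of p rows of q blocks, so the same lemma resolves
   the index a * q + b. *)
rewrite nth_flatten_blocks ?size_map -?enumT ?size_enum_ord //; last first.
  by move=> s; rewrite -map_comp => /mapP[c _ ->]; rewrite /= size_map -?enumT size_enum_ord.
rewrite (nth_map a) ?size_enum_ord // nth_ord_enum.
by rewrite (nth_map b) ?size_enum_ord // nth_ord_enum nth_coords.
Qed.

Local Notation mem0 := (nth 0%R (field_input mul u e A)).

Lemma field_inputE : field_input mul u e A =
  coord_table (fun a b => mul (tnth e a) (tnth e b)) ++ coords e u
  ++ coord_table (fun i j => A i j).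
Proof. by []. Qed.

Lemma mem0_struct (a b l : 'I_r) :
  mem0 ((a * r + b) * r + l) = coord e l (mul (tnth e a) (tnth e b)).
Proof.
have lt : (a * r + b) * r + l < r * r * r.
  apply: (@leq_trans ((a * r + b).+1 * r)); first by rewrite mulSn addnC ltn_add2r.
  rewrite leq_mul2r; apply/orP; right; apply: (@leq_trans (a.+1 * r)).
    by rewrite mulSn addnC ltn_add2r.
  by rewrite leq_mul2r ltn_ord orbT.
by rewrite field_inputE nth_cat size_coord_table lt nth_coord_table.
Qed.

Lemma mem0_unit (l : 'I_r) : mem0 (r * r * r + l) = coord e l u.
Proof.
by rewrite field_inputE nth_cat size_coord_table ltnNge leq_addr /= addKn nth_cat
  size_coords ltn_ord nth_coords.
Qed.

Lemma mem0_entry (i : 'I_k) (j : 'I_n) (l : 'I_r) :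
  mem0 (entry_addr n r i j + l) = coord e l (A i j).
Proof.
rewrite field_inputE /entry_addr -!addnA nth_cat size_coord_table ltnNge leq_addr /= addKn.
by rewrite nth_cat size_coords ltnNge leq_addr /= addKn nth_coord_table.
Qed.

Lemma mem0_out l : mem0 (out_addr n k r + l) = 0%R.
Proof.
rewrite nth_default // field_inputE !size_cat !size_coord_table size_coords /out_addr.
by rewrite -!addnA leq_add2l leq_add2l leq_addr.
Qed.

Hypothesis alg : is_algebra mul.
Hypothesis basis : basis_of fullv e.

Local Notation E := (nth 0%R e).

Lemma coord_expand v : v = (\sum_(l < r) coord e l v *: E l)%R.
Proof. exact: (coord_basis basis (memvf v)). Qed.

Lemma word_vecE w (l : 'I_r) : w < r ^ k ->
  word_vec k r mem0 w k.-1 l =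
  coord e l (oprod mul u [seq E (digit r w i) | i <- iota 0 k]).
Proof.
move: mem0_unit mem0_struct; move: mem0 => f fu fs wk; have [k0|k_gt0] := posnP k.
  by rewrite k0 /= -fu.
have r0 : 0 < r by case: (r) l => [[]|].
have dlt i : digit r w i < r by rewrite ltn_mod.
have -> : iota 0 k = iota 0 k.-1.+1 by rewrite prednK.
elim: k.-1 l => [|i IH] l.
  rewrite /= (gtn_eqF k_gt0) -[nth _ _ _]/(e`_(Ordinal (dlt 0)))%R.
  by rewrite (coord_free _ _ (basis_free basis)) -val_eqE /= eq_sym.
rewrite [LHS]/= iota_rcons.
rewrite map_rcons oprod_rcons //.
set x := oprod mul u _.
(* Expanding the partial product [x] in the basis turns its product with the next letter into
   structure constants. *)
rewrite [x in RHS]coord_expand (linear_fun_sum _ _ _ (algebra_linearl alg _)) linear_sum /=.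
rewrite big_mkord; apply: eq_bigr => a _; rewrite linearZ /= IH; congr (_ * _)%R.
rewrite -[digit _ _ _]/(val (Ordinal (dlt i.+1))) fs !(tnth_nth 0%R).
by [].
Qed.

Lemma word_sumE q (l : 'I_r) :
  word_sum q n k r mem0 (r ^ k) l = coord e l (signed_sum mul u A q).
Proof.
rewrite /signed_sum.
have expand (f : {ffun 'I_k -> 'I_n}) := oprod_expand u alg (r := r) (E := E)
  (X := fun i => A i (f i)) (C := fun i l => mem0 (entry_addr n r i (f i) + l)).
under eq_bigr => f _.
  rewrite expand; last first.
    move=> i; rewrite big_mkord [LHS]coord_expand; apply: eq_bigr => l' _.
    by rewrite mem0_entry.
  rewrite scaler_sumr; under eq_bigr => w _ do rewrite scalerA.
  over.
(* For a fixed word the basis product does not depend on the injection, so its coordinate factors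
   out and a scalar sum remains. *)
rewrite exchange_big /= linear_sum /=; apply: eq_big_nat => w /andP[_ wk].
rewrite -scaler_suml linearZ /= word_vecE //; congr (_ * _)%R.
by rewrite dp_injections.
Qed.

End Input.

(** * Running time *)

(** The 16 covers the program constants. The exponent k + 1 covers 2^k and r^k, and still bounds n,
    r and k + 1 when k = 0. *)
Definition int_bound (n k r : nat) : nat := (n + k + r + 16) ^ k.+1.

Definition run_time (n k r : nat) : nat :=
  main_time n k r * step_cost (int_bound n k r).

Lemma main_time_bound n k r (N := (n + k + r).+1) :
  main_time n k r <= 200 * N ^ 3 * maxn 1 (2 ^ k * r ^ (2 * k)).
Proof.
have K0 : 0 < 2 ^ k by rewrite expn_gt0.
(* The algorithm only meets r^k, which is at most its square r^(2k), also when it vanishes. *)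
have RX : r ^ k * 2 ^ k <= maxn 1 (2 ^ k * r ^ (2 * k)).
  apply: leq_trans (leq_maxr _ _); rewrite mulnC leq_mul2l; apply/orP; right.
  rewrite mul2n -addnn expnD; case: (r ^ k) => // x; exact: leq_pmulr.
(* If r = 0 and k > 0 the product vanishes, and the maximum with 1 pays for the work outside the
   word loop. *)
have X0 : 0 < maxn 1 (2 ^ k * r ^ (2 * k)) by rewrite leq_max.
have nN : n <= N by rewrite /N; lia.
have kN : k <= N by rewrite /N; lia.
have rN : r <= N by rewrite /N; lia.
have N0 : 0 < N by [].
rewrite /main_time /word_time /dp_time /vec_time.
clearbody N; set X := maxn 1 _ in RX X0 *; clearbody X.
move: K0 RX; move: (2 ^ k) (r ^ k) => K R K0 RX.
have N1 : N <= N ^ 3 by rewrite -{1}(expn1 N) leq_pexp2l.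
have N2 : N ^ 2 <= N ^ 3 by rewrite leq_pexp2l.
have N3 : N * N ^ 2 = N ^ 3 by rewrite -expnS.
have one : 1 <= N ^ 3 by rewrite expn_gt0 N0.
have NN : N * N = N ^ 2 by rewrite mulnn.
have k3 : (k + 3) ^ 2 <= 16 * N ^ 2.
  by rewrite -[16]/(4 ^ 2) -expnMn leq_exp2r //; lia.
have KW : N ^ 3 <= K * N ^ 3 by rewrite leq_pmull.
have KW' : K <= K * N ^ 3 by rewrite leq_pmulr.
have WX : N ^ 3 <= X * N ^ 3 by rewrite leq_pmull.
(* The column loop contributes 96 + 6, and the remaining 3K + 5 is at most 8K. *)
have dpB : K * 3 + 2 + (1 + (n * (K * (6 * (k + 3) ^ 2 + 2) + 2 + 2) + 2)) <= K * (110 * N ^ 3).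
  have : n * (6 * (k + 3) ^ 2 + 6) <= N * (6 * (16 * N ^ 2) + 6).
    by apply: leq_mul => //; lia.
  have -> : N * (6 * (16 * N ^ 2) + 6) = 96 * N ^ 3 + 6 * N by rewrite -N3; lia.
  move: ((k + 3) ^ 2) {k3} => P h.
  have h' : K * (n * (6 * P + 6)) <= K * (102 * N ^ 3) by rewrite leq_mul //; lia.
  have Kn : n <= K * n by rewrite leq_pmull.
  lia.
have vecB : r * 3 + 4 + ((k - 1) * (3 * k + r * (r * 3 + 5) + 3 * r + 8 + 2) + 2) <= 34 * N ^ 3.
  have rr : r * (r * 3 + 5) <= N * (8 * N) by apply: leq_mul => //; lia.
  have : (k - 1) * (3 * k + r * (r * 3 + 5) + 3 * r + 8 + 2) <= N * (8 * N ^ 2 + 16 * N).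
    by apply: leq_mul; lia.
  have -> : N * (8 * N ^ 2 + 16 * N) = 8 * N ^ 3 + 16 * N ^ 2 by rewrite -N3; lia.
  lia.
move: dpB vecB; set dpt := _ + (1 + _); set vt := _ + (_ * _ + 2) => dpB vecB.
have wB : dpt + (vt + (r * 3 + 2)) + 2 <= K * (151 * N ^ 3) by lia.
have h1 : R * (dpt + (vt + (r * 3 + 2)) + 2) <= R * (K * (151 * N ^ 3)) by rewrite leq_mul.
have h2 : R * K * (151 * N ^ 3) <= X * (151 * N ^ 3) by rewrite leq_mul.
lia.
Qed.

Lemma step_cost_bound n k r (N := (n + k + r).+1) :
  step_cost (int_bound n k r) <= (2 * max_size * (18 * max_size + 1) + 1) * N ^ 2.
Proof.
have bl : bitlen (int_bound n k r) <= 18 * N ^ 2.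
  apply: leq_trans (bitlen_exp _ _) _.
  have h : bitlen (n + k + r + 16) <= N + 16.
    have : trunc_log 2 (n + k + r + 16) <= n + k + r + 16.
      have := trunc_logP (isT : 1 < 2) (isT : 0 < (n + k + r + 15).+1).
      rewrite -addnS => h; apply: leq_trans h; exact/ltnW/ltn_expl.
    by rewrite /bitlen /N; lia.
  have kN : k.+1 <= N by rewrite /N; lia.
  have := leq_mul kN h; have NN : N <= N * N by rewrite leq_pmull.
  have : 0 < N by []; rewrite -mulnn; lia.
rewrite /step_cost /unit_cost; move: bl; have : 0 < N by [].
move: N (bitlen _) max_size => N b S N0 bl.
have one : 1 <= N ^ 2 by rewrite expn_gt0 N0.
have h1 : S * (S * b) <= S * (S * (18 * N ^ 2)) by rewrite !leq_mul.
have h2 : S <= S * N ^ 2 by rewrite leq_pmulr.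
lia.
Qed.

Lemma run_time_Ostar : Ostar run_time (fun n k r => 2 ^ k * r ^ (2 * k)).
Proof.
move: (2 * max_size * (18 * max_size + 1) + 1) step_cost_bound => C costB.
(* A single constant serves as factor and as exponent: 200 * C is the product of the two factors and
   5 = 3 + 2 the total degree. *)
exists (200 * C + 5) => n k r; set N := (n + k + r).+1.
apply: leq_trans (leq_mul (main_time_bound n k r) (costB n k r)) _; rewrite -/N.
rewrite mulnAC leq_mul2r; apply/orP; right.
rewrite mulnACA -expnD; apply: leq_mul; first exact: leq_addr.
by rewrite leq_pexp2l // leq_addl.
Qed.

Lemma signed_sum_computable q
    (g : forall (F : fieldType) (V : vectType F) (mul : V -> V -> V) (u : V)
           (k n : nat), 'M[V]_(k, n) -> V) :
  (forall F V mul u k n A, g F V mul u k n A = signed_sum mul u A q) ->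
  computable_in_Ostar g (fun n k r => 2 ^ k * r ^ (2 * k)).
Proof.
move=> gE; exists (main_cmd q), run_time; split; first exact: run_time_Ostar.
move=> F r V mul e u k n A alg basis _.
set M := int_bound n k r.
have expM b i : b <= n + k + r + 16 -> i <= k.+1 -> b ^ i <= M.
  move=> bM ik; apply: (@leq_trans ((n + k + r + 16) ^ i)).
    by case: i {ik} => // i; rewrite leq_exp2r.
  by rewrite leq_pexp2l // addn_gt0 orbT.
have leM b : b <= n + k + r + 16 -> b <= M by move=> bM; rewrite -[b]expn1 expM.
have M16 : 16 <= M by apply: leM; lia.
have nM : n <= M by apply: leM; lia.
have kM : k.+1 <= M by apply: leM; lia.
have rM : r <= M by apply: leM; lia.
have pow2M i : i <= k -> 2 ^ i <= M by move=> ik; apply: expM; lia.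
have powrM i : i <= k -> r ^ i <= M by move=> ik; apply: expM; lia.
pose f0 := nth 0%R (field_input mul u e A).
have f0out l : l < r -> f0 (out_addr n k r + l) = 0%R by rewrite /f0 mem0_out.
have [f [t [ex tB fE]]] :=
  main_cmdP q M16 nM kM rM pow2M powrM f0out (erefl f0).
exists t, (Ram (regs n k r (r ^ k) (2 ^ k) 0 0 0 0 0 0 0 0 0) f); split=> //.
apply: (@eq_from_nth _ 0%R); rewrite size_mkseq ?size_coords // => l lr.
rewrite nth_mkseq //= fE // gE.
by rewrite -[l]/(val (Ordinal lr)) nth_coords /f0 (word_sumE u A alg basis).
Qed.

Theorem theorem5 :
  computable_in_Ostar rper (fun n k r => 2 ^ k * r ^ (2 * k)) /\
  computable_in_Ostar rdet (fun n k r => 2 ^ k * r ^ (2 * k)).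
Proof.
split.
- by apply: (signed_sum_computable (q := false)) => *; apply: rper_signed_sum.
- by apply: (signed_sum_computable (q := true)) => *; apply: rdet_signed_sum.
Qed.
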